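(* Let $n\ge 3$ and let $\beta=(\beta_1,\ldots,\beta_n)$ be a multi-index of real numbers with $\beta_k>-1/2$ for $1\le k\le n$. Then $$\int_{B(0,1)}x^{2\beta}\,dx=\frac{1}{\Gamma\big((|\beta|+1)+n/2\big)}\prod_{k=1}^n\Gamma(\beta_k+1/2).$$ In particular, when $\beta=\alpha$ is a multi-index of nonnegative integers, $$\frac1{v_n}\int_{B(0,1)}x^{2\alpha}\,dx=\frac{\prod_{1\le k\le n,\ \alpha_k\ne 0}(2\alpha_k-1)!!}{(n+2|\alpha|)(n+2|\alpha|-2)\cdots(n+2)}.$$ Furthermore, for every $1\le m\le n$, as $\beta_1,\ldots,\beta_m\to\infty$ (with $\beta_{m+1},\ldots,\beta_n$ fixed), $$\int_{B(0,1)}x^{2\beta}\,dx\sim (2\pi)^{(m-1)/2}\,e^{(\beta_{m+1}+\cdots+\beta_n)}\prod_{k=m+1}^n\Gamma(\beta_k+1/2)\;\frac{\prod_{k=1}^m\beta_k^{\beta_k}}{|\beta|^{|\beta|+(n+1)/2}}.$$ And if all the $\beta_j\to\infty$, then $$\int_{B(0,1)}x^{2\beta}\,dx\sim (2\pi)^{(n-1)/2}\,\frac{\prod_{k=1}^n\beta_k^{\beta_k}}{|\beta|^{|\beta|+(n+1)/2}}.$$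
   Context: $B(0,1)$ is the unit ball of $\mathbb{R}^n$ and $v_n=\omega_n/n$ its volume, where $\omega_n=2\pi^{n/2}/\Gamma(n/2)$ is the surface area of the unit sphere; $\Gamma(s)=\int_0^\infty e^{-t}t^{s-1}\,dt$ for $s>0$. For a multi-index $\beta$ of real numbers, $|\beta|=\beta_1+\cdots+\beta_n$ (the plain sum, without absolute values) and $x^{2\beta}=|x_1|^{2\beta_1}\cdots|x_n|^{2\beta_n}$. For an odd positive integer $k$, $k!!=k(k-2)\cdots 1$. The denominator $(n+2|\alpha|)(n+2|\alpha|-2)\cdots(n+2)$ is $\prod_{j=1}^{|\alpha|}(n+2j)$, and empty products equal $1$. The notation $F\sim G$ means that the ratio $F/G$ tends to $1$ in the indicated limit. *)

(* Defs.v *)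
From HB Require Import structures.
From mathcomp Require Import all_boot all_order all_algebra.
From mathcomp Require Import all_classical all_reals all_analysis.

Set Implicit Arguments.
Unset Strict Implicit.
Unset Printing Implicit Defensive.
Import Order.TTheory GRing.Theory Num.Theory.
Import numFieldNormedType.Exports.

Local Open Scope classical_set_scope.
Local Open Scope ring_scope.

Section tuple_measure.
Context d (T : measurableType d) (R : realType).
Variable mu : {sigma_finite_measure set T -> \bar R}.

Section step.
Variable n : nat.
Variable m : {sigma_finite_measure set (n.-tuple T) -> \bar R}.

Definition tcons (p : T * n.-tuple T) : n.+1.-tuple T :=
  [the n.+1.-tuple T of p.1 :: p.2].

Lemma measurable_tcons : measurable_fun [set: T * n.-tuple T] tcons.
Proof. exact: measurable_cons. Qed.

Definition tuple_measureS : set (n.+1.-tuple T) -> \bar R :=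
  pushforward (mu \x m)%E tcons.

Let tuple_measureS0 : tuple_measureS set0 = 0%E.
Proof. by rewrite /tuple_measureS /pushforward preimage_set0 measure0. Qed.

Let tuple_measureS_ge0 A : (0 <= tuple_measureS A)%E.
Proof. by rewrite /tuple_measureS /pushforward measure_ge0. Qed.

Let tuple_measureS_sigma_additive : semi_sigma_additive tuple_measureS.
Proof.
have mtcons := measurable_tcons.
exact: measure_semi_sigma_additive.
Qed.

HB.instance Definition _ := isMeasure.Build _ _ _ tuple_measureS
  tuple_measureS0 tuple_measureS_ge0 tuple_measureS_sigma_additive.

Let tuncons (t : n.+1.-tuple T) : T * n.-tuple T :=
  (thead t, [tuple of behead t]).

Let measurable_tuncons : measurable_fun [set: n.+1.-tuple T] tuncons.
Proof.
apply/measurable_fun_pairP; split; first exact: measurable_tnth.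
exact: measurable_behead.
Qed.

Let tconsK : cancel tcons tuncons.
Proof. by move=> [x t]; congr pair; apply/val_inj. Qed.

Let tuple_measureS_sigma_finite : sigma_finite setT tuple_measureS.
Proof.
have /sigma_finiteP[F [FT ndF Foo]] := sigma_finiteT mu.
have /sigma_finiteP[G [GT ndG Goo]] := sigma_finiteT m.
exists (fun k => tuncons @^-1` (F k `*` G k)).
  rewrite -preimage_bigcup (_ : \bigcup_i _ = setT) ?preimage_setT//.
  rewrite -subTset => -[x t] _.
  have : [set: T] x by []. rewrite FT => -[i _ Fx].
  have : [set: n.-tuple T] t by []. rewrite GT => -[j _ Gt].
  exists (maxn i j) => //; split.
    by move: x Fx; exact/subsetPset/ndF/leq_maxl.
  by move: t Gt; exact/subsetPset/ndG/leq_maxr.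
move=> k; have [mF Fk] := Foo k; have [mG Gk] := Goo k; split.
  rewrite -[X in measurable X]setTI; apply: measurable_tuncons => //.
  exact: measurableX.
rewrite /tuple_measureS /pushforward -comp_preimage (_ : _ \o _ = id).
  by rewrite preimage_id product_measure1E// lte_mul_pinfty// ge0_fin_numE.
by apply/funext => p /=; rewrite tconsK.
Qed.

HB.instance Definition _ := Measure_isSigmaFinite.Build _ _ _ tuple_measureS
  tuple_measureS_sigma_finite.

End step.

(* The n-fold product of mu; see tuple_measure_box. *)
Fixpoint tuple_measure n : {sigma_finite_measure set (n.-tuple T) -> \bar R} :=
  match n with
  | 0 => [the {sigma_finite_measure set _ -> \bar R} of dirac [tuple]]
  | n'.+1 => [the {sigma_finite_measure set _ -> \bar R} of
               tuple_measureS (tuple_measure n')]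
  end.

Lemma tuple_measure_box n (A : 'I_n -> set T) :
  (forall i, measurable (A i)) ->
  tuple_measure n [set t | forall i, A i (tnth t i)] =
  (\prod_(i < n) mu (A i))%E.
Proof.
elim: n A => [|n IH] A mA.
  rewrite big_ord0 /= diracE mem_set//.
  by move=> -[].
rewrite big_ord_recl -IH//= /tuple_measureS /pushforward.
rewrite -product_measure1E//; last first.
  rewrite (_ : mkset _ =
    \bigcap_(i in [set: 'I_n]) ((@tnth _ T)^~ i @^-1` A (lift ord0 i))).
    apply: fin_bigcap_measurable => //= i _.
    by rewrite -[X in measurable X]setTI; exact: measurable_tnth.
  by apply/seteqP; split => t /= h i => [_|]; exact: h.
congr (_ _); apply/seteqP; split => -[x t] /=.
  move=> h; split; first exact: (h ord0).
  by move=> i; have := h (lift ord0 i); rewrite tnthS.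
move=> [hx ht] i; case: (unliftP ord0 i) => [j ->|->//].
by rewrite tnthS.
Qed.

End tuple_measure.

Definition lebesgue_tuple (R : realType) (n : nat) :=
  tuple_measure (@lebesgue_measure R) n.

Section gamma.
Context {R : realType}.

Definition Gamma (s : R) : R :=
  (\int[lebesgue_measure]_(t in `]0%R, +oo[) (expR (- t) * t `^ (s - 1)))%R.

(* sphere_area and ball_volume are taken to be the closed forms, not the
   measures of the sphere and of the ball. *)
Definition sphere_area (n : nat) : R :=
  2 * pi `^ (n%:R / 2) / Gamma (n%:R / 2).

Definition ball_volume (n : nat) : R := sphere_area n / n%:R.

End gamma.

Section ball.
Context {R : realType} {n : nat}.
Local Notation Rn := (n.-tuple (measurableTypeR R)).

Definition enorm (x : Rn) : R := Num.sqrt (\sum_(k < n) tnth x k ^+ 2).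

Definition unit_ball : set Rn := [set x | enorm x < 1].

(* x^{2b}. Where some x_k = 0 and b_k < 0, the convention of powR gives 0; such
   x form a null set. *)
Definition monomial2 (b : 'I_n -> R) (x : Rn) : R :=
  \prod_(k < n) `|tnth x k| `^ (2 * b k).

Definition multi_sum (b : 'I_n -> R) : R := \sum_(k < n) b k.

End ball.

Fixpoint double_fact (k : nat) : nat :=
  if k is k'.+2 then (k * double_fact k')%N else 1%N.

Section limits.
Context {R : realType} {n : nat}.

(* The first m coordinates tend to +oo jointly, the others are those of g. *)
Definition first_to_pinfty (m : nat) (g : 'I_n -> R) : set_system ('I_n -> R) :=
  filter_from [set: R] (fun M =>
    [set b | forall k : 'I_n,
       ((k < m)%N -> M < b k) /\ ((m <= k)%N -> b k = g k)]).

Definition all_to_pinfty : set_system ('I_n -> R) :=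
  filter_from [set: R] (fun M => [set b | forall k, M < b k]).

Global Instance first_to_pinfty_filter m g :
  ProperFilter (first_to_pinfty m g).
Proof.
apply: filter_from_proper.
  apply: filter_from_filter; first by exists 0.
  move=> M N _ _; exists (Num.max M N) => // b /= h.
  split=> k; have [hlt hge] := h k; split=> // /hlt.
    by rewrite gt_max => /andP[].
  by rewrite gt_max => /andP[].
move=> M _; exists (fun k : 'I_n => if (k < m)%N then M + 1 else g k) => k /=.
by case: ltnP => //; rewrite ltrDl.
Qed.

Global Instance all_to_pinfty_filter : ProperFilter all_to_pinfty.
Proof.
apply: filter_from_proper.
  apply: filter_from_filter; first by exists 0.
  move=> M N _ _; exists (Num.max M N) => // b /= h.
  by split=> k; have := h k; rewrite gt_max => /andP[].
by move=> M _; exists (fun=> M + 1) => k /=; rewrite ltrDl.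
Qed.

End limits.

(* Main.v *)
From HB Require Import structures.
Require Import Defs.
From mathcomp Require Import all_boot all_order all_algebra.
From mathcomp Require Import all_classical all_reals all_analysis.
From mathcomp Require Import measurable_realfun ring lra.
Import Order.TTheory GRing.Theory Num.Theory.
Import numFieldNormedType.Exports.
Local Open Scope classical_set_scope.
Local Open Scope ring_scope.

(** The Gaussian moment of x^{2 b} over R^n is a product of one-dimensional
    moments, hence of the Gamma (b_k + 1/2). Slicing exp (- |x|^2) into the
    balls |x|^2 < t and scaling each of them to the unit ball, the same moment
    is the integral over the unit ball times Gamma (|b| + n/2 + 1). The case of
    integer exponents follows from the functional equation of Gamma and from
    Gamma (1/2) = sqrt pi.

    The asymptotics come from Stirling's formula for real arguments. The
    function L s = Gamma s * e^s * s^(1/2 - s) is decreasing along s, s + 1,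
    s + 2, ..., with summable logarithmic increments, so L has a positive limit
    along the integers; log-convexity of Gamma turns it into a limit at
    infinity, and Legendre's duplication formula at the integers identifies it
    as sqrt (2 pi). *)

Set Implicit Arguments.
Unset Strict Implicit.

(** * Lebesgue integration over tuples *)

Lemma measurable_set_lt {d} {T : measurableType d} {R : realType} (f g : T -> R) :
  measurable_fun setT f -> measurable_fun setT g ->
  measurable [set x | f x < g x].
Proof.
move=> mf mg.
rewrite (_ : mkset _ = [set: T] `&` (fun x => f x < g x) @^-1` [set true]).
  by apply: measurable_fun_ltr.
by apply/seteqP; split => x /=; [move=> ->|case].
Qed.

Section scaling.
Context {R : realType}.
Local Notation mu := (@lebesgue_measure R).

(** By uniqueness of Lebesgue measure, a multiple of [nu] that agrees with it on bounded half-open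
    intervals is Lebesgue measure. A change of variables thus reduces to computing lengths. *)
Lemma lebesgue_measure_unique_scale (c : R) (c0 : 0 <= c)
    (nu : {measure set (measurableTypeR R) -> \bar R}) :
  (forall X, ocitv X -> mu X = (c%:E * nu X)%E) ->
  forall f : R -> \bar R, measurable_fun setT f -> (forall x, (0 <= f x)%E) ->
  (\int[mu]_x f x = c%:E * \int[nu]_x f x)%E.
Proof.
move=> h f mf f0; rewrite -[c]/((NngNum c0)%:num) -ge0_integral_mscale//.
apply: eq_measure_integral => A mA _.
exact: (@lebesgue_measure_unique R (mscale (NngNum c0) nu)).
Qed.

Lemma ge0_integral_scale (c : R) (f : R -> \bar R) : 0 < c ->
  measurable_fun [set: R] f -> (forall x, (0 <= f x)%E) ->
  (\int[mu]_x f x = c%:E * \int[mu]_x f (c * x)%R)%E.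
Proof.
move=> c0 mf f0.
have mc : measurable_fun [set: measurableTypeR R] ( *%R c : _ -> measurableTypeR R).
  exact: mulrl_measurable.
have := ge0_integral_pushforward mc mu measurableT mf (fun x _ => f0 x).
rewrite preimage_setT/= => <-.
apply: lebesgue_measure_unique_scale => //; first exact: ltW.
(* The preimage of a half-open interval under multiplication by [c] is the interval with endpoints
   divided by [c]. *)
move=> _ [[a b] _ <-]; rewrite /= /pushforward.
rewrite (_ : _ @^-1` _ = `]a / c, b / c]%classic); last first.
  by apply/seteqP; split => x /=; rewrite !in_itv/= ler_pdivlMr// ltr_pdivrMr// [x * c]mulrC.
rewrite !lebesgue_measure_itv/= !lte_fin ltr_pM2r ?invr_gt0//.
case: ifPn => _; last by rewrite mule0.
by rewrite -!EFinB -EFinM -mulrBl mulrC divfK// gt_eqF.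
Qed.

End scaling.

Section tuple_integral.
Context d (T : measurableType d) (R : realType).
Variable mu : {sigma_finite_measure set T -> \bar R}.

Lemma ge0_integral_tuple0 (f : 0.-tuple T -> \bar R) :
  measurable_fun setT f ->
  (\int[tuple_measure mu 0]_x f x = f [tuple])%E.
Proof. by move=> mf; rewrite /= integral_dirac// diracT mul1e. Qed.

Lemma ge0_integral_tupleS n (f : n.+1.-tuple T -> \bar R) :
  measurable_fun setT f -> (forall x, (0 <= f x)%E) ->
  (\int[tuple_measure mu n.+1]_x f x =
   \int[mu]_x \int[tuple_measure mu n]_t f (tcons (x, t)))%E.
Proof.
move=> mf f0.
have := @ge0_integral_pushforward _ _ _ _ R _ (@measurable_tcons _ T n)
  (mu \x tuple_measure mu n)%E setT f measurableT mf (fun x _ => f0 x).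
rewrite preimage_setT => /= E.
rewrite [LHS]E fubini_tonelli1//.
by apply: measurableT_comp => //; exact: measurable_tcons.
Qed.

Lemma measurable_tuple_prod (R' : realType) n (h : 'I_n -> T -> R') :
  (forall k, measurable_fun setT (h k)) ->
  measurable_fun setT (fun x : n.-tuple T => \prod_(k < n) h k (tnth x k)).
Proof.
move=> mh.
apply: measurable_prod => k _.
by apply: measurableT_comp => //; exact: measurable_tnth.
Qed.

(** Tonelli for separated variables: induction on [n], pulling the factor of the first coordinate
    out of the inner integral. *)
Lemma ge0_integral_tuple_prod n (h : 'I_n -> T -> R) :
  (forall k, measurable_fun setT (h k)) -> (forall k x, 0 <= h k x) ->
  (\int[tuple_measure mu n]_x (\prod_(k < n) h k (tnth x k))%:E =
   \prod_(k < n) \int[mu]_x (h k x)%:E)%E.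
Proof.
elim: n h => [|n IH] h mh h0.
  rewrite ge0_integral_tuple0; last by apply/measurable_EFinP; apply: measurable_tuple_prod.
  by rewrite !big_ord0.
rewrite ge0_integral_tupleS; last 2 first.
- by apply/measurable_EFinP; apply: measurable_tuple_prod.
- by move=> x; rewrite lee_fin prodr_ge0.
rewrite big_ord_recl.
have P0 : (0 <= \prod_(k < n) \int[mu]_x (h (lift ord0 k) x)%:E)%E.
  by apply: prode_ge0 => k _; apply: integral_ge0 => x _; rewrite lee_fin.
transitivity (\int[mu]_x ((\prod_(k < n) \int[mu]_y (h (lift ord0 k) y)%:E)
   * (h ord0 x)%:E))%E; last first.
  rewrite ge0_integralZl.
  - by rewrite muleC.
  - exact: measurableT.
  - exact/measurable_EFinP.
  - by move=> x _; rewrite lee_fin.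
  - exact: P0.
apply: eq_integral => x _; rewrite -IH; [|by move=> k|by move=> k].
rewrite muleC -ge0_integralZl.
2: exact: measurableT.
2: by apply/measurable_EFinP; apply: (measurable_tuple_prod (h := fun k => h (lift ord0 k))).
2: by move=> t _; rewrite lee_fin prodr_ge0.
2: by rewrite lee_fin.
apply: eq_integral => t _; rewrite big_ord_recl EFinM.
congr (_ * _)%E; congr (_%:E); apply: eq_bigr => k _.
by rewrite tnthS.
Qed.

End tuple_integral.

Section tuple_scaling.
Context {R : realType}.

Lemma measurable_map_tuple_scale n (c : R) :
  measurable_fun setT
    (map_tuple ( *%R c) : n.-tuple (measurableTypeR R) -> n.-tuple (measurableTypeR R)).
Proof.
apply/measurable_fun_tnthP => k.
rewrite (_ : _ \o _ = *%R c \o (@tnth n (measurableTypeR R))^~ k).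
  by apply: measurableT_comp; [exact: mulrl_measurable|exact: measurable_tnth].
by apply/funext => x /=; rewrite tnth_map.
Qed.

(** Induction on [n]: the first coordinate contributes one factor [c] by the one-dimensional rule,
    the remaining ones contribute the rest. *)
Lemma ge0_integral_tuple_scale n (c : R)
    (f : n.-tuple (measurableTypeR R) -> \bar R) : 0 < c ->
  measurable_fun setT f -> (forall x, (0 <= f x)%E) ->
  (\int[lebesgue_tuple R n]_x f x =
   (c ^+ n)%:E * \int[lebesgue_tuple R n]_x f (map_tuple ( *%R c) x))%E.
Proof.
move=> c0; elim: n f => [|n IH] f mf f0.
  rewrite /lebesgue_tuple !ge0_integral_tuple0//.
    by rewrite mul1e; congr f; apply: val_inj.
  by apply: measurableT_comp => //; exact: measurable_map_tuple_scale.
rewrite /lebesgue_tuple ge0_integral_tupleS// -/(lebesgue_tuple R n).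
rewrite ge0_integral_tupleS//; last first.
  by apply: measurableT_comp => //; exact: measurable_map_tuple_scale.
have mft : measurable_fun setT (f \o @tcons _ (measurableTypeR R) n).
  by apply: measurableT_comp => //; exact: measurable_tcons.
have mF : measurable_fun setT (fun x => \int[lebesgue_tuple R n]_t f (tcons (x, t)))%E.
  by apply: (measurable_fun_fubini_tonelli_F _ mft) => z; exact: f0.
rewrite (ge0_integral_scale c0 mF); last by move=> x; apply: integral_ge0.
rewrite exprS EFinM -muleA; congr (_ * _)%E.
have mfs : measurable_fun setT ((f \o map_tuple ( *%R c)) \o @tcons _ (measurableTypeR R) n).
  apply: measurableT_comp (@measurable_tcons _ _ n).
  by apply: measurableT_comp => //; exact: measurable_map_tuple_scale.
rewrite -ge0_integralZl//; last 3 first.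
- by apply: (measurable_fun_fubini_tonelli_F _ mfs) => z; exact: f0.
- by move=> x _; apply: integral_ge0.
- by rewrite lee_fin exprn_ge0// ltW.
apply: eq_integral => x _.
rewrite [LHS]IH//; last first.
  by apply: measurableT_comp mft _.
congr (_ * _)%E; apply: eq_integral => t _; congr f.
exact: val_inj.
Qed.

End tuple_scaling.

(** * The layer-cake formula for exponential weights *)

Section exponential.
Context {R : realType}.

Lemma integral_expRN (u : R) :
  (\int[lebesgue_measure]_(t in `]u, +oo[) (expR (- t))%:E = (expR (- u))%:E)%E.
Proof.
have mexp : measurable_fun setT (fun t : R => expR (- t)).
  by apply: measurableT_comp => //; exact: measurableT_comp.
have cexp : continuous (fun t : R => - expR (- t)).
  move=> t; apply: cvgN; apply: continuous_comp; first exact: cvgN.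
  exact: continuous_expR.
have D (x : R) : is_derive x 1 (fun t => - expR (- t)) (expR (- x)).
  by apply: is_derive_eq; rewrite /GRing.scale/=; ring.
rewrite integral_itv_obnd_cbnd; last first.
  by apply/measurable_EFinP; exact: measurable_funTS.
rewrite (@ge0_continuous_FTC2y _ _ (fun t => - expR (- t)) _ 0).
- by rewrite EFinN oppeK add0e.
- by move=> x _; exact: expR_ge0.
- apply: continuous_subspaceT => t; apply: continuous_comp; first exact: cvgN.
  exact: continuous_expR.
- rewrite -[X in _ --> X]oppr0; apply: cvgN; exact: cvgr_expR.
- by move=> x _; apply: ex_derive.
- by apply: cvg_at_right_filter; exact: cexp.
- by move=> x _; rewrite derive1E derive_val.
Qed.

(* Tonelli, after writing [expR (- q x)] as the integral of [expR (- t)] over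
   [t > q x]. *)
Lemma layer_cake d (T : measurableType d) (mu : {sigma_finite_measure set T -> \bar R})
    (D : set T) (f q : T -> R) :
  measurable D -> measurable_fun setT f -> measurable_fun setT q ->
  (forall x, 0 <= f x) -> (forall x, D x -> 0 <= q x) ->
  (\int[mu]_(x in D) (f x * expR (- q x))%:E =
   \int[lebesgue_measure]_(t in `]0%R, +oo[)
     ((expR (- t))%:E * \int[mu]_(x in D `&` [set x | q x < t]%R) (f x)%:E))%E.
Proof.
move=> mD mf mq f0 q0.
have mexp : measurable_fun setT (fun t : R => expR (- t)).
  by apply: measurableT_comp => //; exact: measurableT_comp.
(* The region above the graph of [q] over [D]; its sections in the two directions give the two
   iterated integrals. *)
pose A : set (T * measurableTypeR R) := [set z | D z.1 /\ q z.1 < z.2].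
have mA : measurable A.
  rewrite (_ : A = (fst @^-1` D) `&` [set z | q z.1 < z.2])//.
  apply: measurableI.
    by rewrite -[X in measurable X]setTI; exact: measurable_fst.
  by apply: measurable_set_lt => //; exact: measurableT_comp.
pose h (z : T * measurableTypeR R) := (f z.1 * expR (- z.2) * \1_A z)%:E.
have h0 z : (0 <= h z)%E by rewrite lee_fin !mulr_ge0// expR_ge0.
have mh : measurable_fun setT h.
  apply/measurable_EFinP; apply: measurable_funM; last exact: measurable_indic.
  apply: measurable_funM; first exact: (measurableT_comp mf measurable_fst).
  exact: (measurableT_comp mexp measurable_snd).
have mqt (t : R) : measurable [set x | q x < t].
  exact: measurable_set_lt.
transitivity (\int[mu]_x \int[lebesgue_measure]_t h (x, t))%E.
  rewrite integral_mkcond; apply: eq_integral => x _.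
  rewrite patchE; case: ifPn => xD; last first.
    rewrite integral0_eq// => t _; rewrite /h indicE /A memNset/= ?mulr0//.
    by move=> [/mem_set]; rewrite (negbTE xD).
  rewrite EFinM -integral_expRN -ge0_integralZl//; last 2 first.
  - by apply/measurable_EFinP; exact: measurable_funTS.
  - by rewrite lee_fin.
  rewrite integral_mkcond; apply: eq_integral => t _.
  rewrite patchE /h indicE; case: ifPn.
    rewrite inE/= in_itv/= andbT => qt.
    by rewrite mem_set ?mulr1//=; split => //; exact: set_mem.
  rewrite notin_setE/= in_itv/= andbT => qt.
  by rewrite memNset ?mulr0//= => -[].
rewrite fubini_tonelli// [RHS]integral_mkcond.
apply: eq_integral => t _; rewrite patchE; case: ifPn; last first.
  (* For [t <= 0] the section is empty because [q] is nonnegative on [D]. *)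
  rewrite notin_setE/= in_itv/= andbT => /negP; rewrite -leNgt => t0.
  rewrite integral0_eq// => x _; rewrite /h indicE memNset ?mulr0// => -[Dx /=].
  by move=> /(le_lt_trans (q0 x Dx)); rewrite ltNge t0.
rewrite inE/= in_itv/= andbT => t0.
have mDq : measurable (D `&` [set x | q x < t]) by exact: measurableI.
rewrite -ge0_integralZl.
2: exact: mDq.
2: by apply/measurable_EFinP; exact: measurable_funTS.
2: by move=> x _; rewrite lee_fin.
2: by rewrite lee_fin expR_ge0.
rewrite [RHS]integral_mkcond; apply: eq_integral => x _.
rewrite patchE /h indicE; case: ifPn.
  by rewrite inE/= => -[Dx qt]; rewrite mem_set ?mulr1 ?[f x * _]mulrC.
by rewrite notin_setE/= => Dx; rewrite memNset ?mulr0.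
Qed.

End exponential.

(** * The Gamma integral *)

Section power_integral.
Context {R : realType}.
Local Notation mu := (@lebesgue_measure R).

(** For [s < 1] the integrand blows up at 0, so the fundamental theorem of calculus is applied on
    [[e n, r]] and [e n] is sent to 0 by monotone convergence. *)
Lemma integral_powR (s r : R) : 0 < s -> 0 < r ->
  (\int[mu]_(u in `]0%R, r[) (u `^ (s - 1))%:E = (r `^ s / s)%:E)%E.
Proof.
move=> s0 r0.
have mp : measurable_fun setT (fun u : R => u `^ (s - 1)).
  exact: measurable_powR.
rewrite integral_itv_bndo_bndc; last by apply/measurable_EFinP; exact: measurable_funTS.
(* The offset 2 makes [e n < r] hold already at [n = 0]. *)
pose e (n : nat) : R := r * n.+2%:R^-1.
have e0 n : 0 < e n by rewrite mulr_gt0.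
have er n : e n < r by rewrite gtr_pMr// invf_lt1// ltr1n.
have ecvg : e n @[n --> \oo] --> (0 : R).
  rewrite -[X in _ --> X](mulr0 r); apply: cvgMr.
  apply/cvgrPdist_lt => x x0.
  near=> n; rewrite sub0r normrN ger0_norm//.
  rewrite (@le_lt_trans _ _ (n.+1%:R^-1))//; first by rewrite lef_pV2// ?posrE// ler_nat.
  by near: n; exact: near_infty_natSinv_lt (PosNum x0).
have -> : `]0, r]%classic = \bigcup_n `[e n, r]%classic.
  apply/seteqP; split => [x|x [n _]]/=; rewrite !in_itv/=.
    move=> /andP[x0 xr].
    have [n _ /(_ n (leqnn n)) hn] : \forall n \near \oo, e n <= x.
      move/cvgrPdist_le : ecvg => /(_ x x0) [N _ hN]; exists N => // n /hN.
      by rewrite sub0r normrN gtr0_norm.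
    by exists n => //=; rewrite in_itv/= hn.
  by move=> /andP[ex ->]; rewrite (lt_le_trans _ ex).
transitivity (limn (fun n => \int[mu]_(u in `[e n, r]) (u `^ (s - 1))%:E)%E).
  apply/esym/cvg_lim => //.
  apply: ge0_nondecreasing_set_cvg_integral => //.
  - apply/nondecreasing_seqP => n; rewrite subsetEset => x/=; rewrite !in_itv/=.
    move=> /andP[ex ->]; rewrite andbT (le_trans _ ex)// ler_wpM2l ?ltW//.
    by rewrite ltf_pV2// ?posrE// ltr_nat.
  - by move=> n; apply/measurable_EFinP; exact: measurable_funTS.
  - by move=> n x _; rewrite lee_fin powR_ge0.
pose F (u : R) := s^-1 * u `^ s.
have dF (x : R) : 0 < x -> is_derive x 1 F (x `^ (s - 1)).
  move=> x0; apply: (is_derive_eq (is_deriveZ s^-1 (is_derive1_powR s x0))).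
  by rewrite /GRing.scale/= mulKf ?gt_eqF.
have cF (x : R) : 0 < x -> {for x, continuous F}.
  move=> x0; apply: differentiable_continuous; apply/derivable1_diffP.
  by have [] := dF _ x0.
have cp (x : R) : 0 < x -> {for x, continuous (fun u : R => u `^ (s - 1))}.
  move=> x0; apply: differentiable_continuous; apply/derivable1_diffP.
  by apply: derivable_powR; rewrite in_itv/= x0.
have E n : (\int[mu]_(u in `[e n, r]) (u `^ (s - 1))%:E = (F r)%:E - (F (e n))%:E)%E.
  apply: continuous_FTC2 => //.
  - apply: continuous_in_subspaceT => x; rewrite inE/= in_itv/= => /andP[ex _].
    by apply: cp; exact: lt_le_trans ex.
  - split => [x||].
    + rewrite in_itv/= => /andP[ex _].
      by have [] := dF _ (lt_trans (e0 n) ex).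
    + by apply: cvg_at_right_filter; exact: cF.
    + by apply: cvg_at_left_filter; exact: cF.
  - move=> x; rewrite in_itv/= => /andP[ex _].
    by have Dx := dF _ (lt_trans (e0 n) ex); rewrite derive1E derive_val.
apply/cvg_lim => //.
under eq_cvg do rewrite E -EFinB.
apply: cvg_EFin; first exact: nearW.
rewrite [X in _ --> X](_ : _ = F r - s^-1 * 0); last by rewrite /F mulr0 subr0 mulrC.
apply: cvgB; first exact: cvg_cst.
apply: cvgMr.
apply: (@cvg_comp _ _ _ e (fun u => u `^ s) _ (0^'+)); last exact: powR_cvg0.
move=> A [x /= x0 hA].
move/cvgrPdist_lt : ecvg => /(_ _ x0); apply: filterS => n hn.
by apply: hA => //=.
Unshelve. all: end_near. Qed.

End power_integral.

Section Gamma_integral.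
Context {R : realType}.
Local Notation mu := (@lebesgue_measure R).

(** Extended-real version of [Gamma], usable before the integral is known to be finite. *)
Definition eGamma (s : R) : \bar R :=
  (\int[mu]_(t in `]0%R, +oo[) (expR (- t) * t `^ (s - 1))%:E)%E.

Lemma measurable_Gamma_integrand (s : R) (D : set R) :
  measurable_fun D (fun t => (expR (- t) * t `^ (s - 1))%:E).
Proof.
apply: measurable_funTS; apply/measurable_EFinP; apply: measurable_funM.
  by apply: measurableT_comp => //; exact: measurableT_comp.
exact: measurable_powR.
Qed.

Lemma Gamma_integrand_ge0 (s t : R) : (0 <= (expR (- t) * t `^ (s - 1))%:E)%E.
Proof. by rewrite lee_fin mulr_ge0// ?expR_ge0// powR_ge0. Qed.

#[local] Hint Resolve measurable_Gamma_integrand Gamma_integrand_ge0 : core.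

Lemma eGamma_ge0 s : (0 <= eGamma s)%E.
Proof. exact: integral_ge0. Qed.

(** When the integral of [f] over the sublevel sets of [q] grows like [t^p], the layer-cake formula
    leaves exactly a Gamma integral. This one principle yields the functional equation, the Gaussian
    moments on the line and the integral over the ball. *)
Lemma layer_cake_power d (T : measurableType d)
    (m : {sigma_finite_measure set T -> \bar R})
    (D : set T) (f q : T -> R) (p : R) (c : \bar R) :
  measurable D -> measurable_fun setT f -> measurable_fun setT q ->
  (forall x, 0 <= f x) -> (forall x, D x -> 0 <= q x) -> (0 <= c)%E ->
  (forall t : R, (0 < t)%R ->
    \int[m]_(x in D `&` [set x | q x < t]%R) (f x)%:E = c * (t `^ p)%:E)%E ->
  (\int[m]_(x in D) (f x * expR (- q x))%:E = c * eGamma (p + 1))%E.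
Proof.
move=> mD mf mq f0 q0 c0 h.
rewrite layer_cake// -ge0_integralZl//; last exact: measurable_Gamma_integrand.
apply: eq_integral => t; rewrite inE/= in_itv/= andbT => t0.
by rewrite h// muleCA EFinM addrK.
Qed.

(** The layer-cake formula replaces integration by parts: with [q u = u], the integral of
    [u^(s - 1)] over []0, t[] is [t^s / s]. *)
Lemma eGammaD1 (s : R) : 0 < s -> (eGamma (s + 1) = s%:E * eGamma s)%E.
Proof.
move=> s0.
have -> : (eGamma s = (s^-1)%:E * eGamma (s + 1))%E.
  rewrite -(@layer_cake_power _ _ mu `]0, +oo[%classic (fun u => u `^ (s - 1)) id)//.
  - by apply: eq_integral => t _; rewrite mulrC.
  - by move=> x; exact: powR_ge0.
  - by move=> x; rewrite /= in_itv/= andbT => /ltW.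
  - by rewrite lee_fin invr_ge0 ltW.
  move=> t t0; rewrite (_ : _ `&` _ = `]0, t[%classic).
    by rewrite integral_powR// mulrC EFinM.
  by apply/seteqP; split => x/=; rewrite !in_itv/= andbT => /andP.
by rewrite muleA -EFinM mulfV ?gt_eqF// mul1e.
Qed.

Lemma eGamma1 : eGamma 1 = 1%E.
Proof.
transitivity (expR (- (0 : R)))%:E; last by rewrite oppr0 expR0.
rewrite -integral_expRN.
by apply: eq_integral => t _; rewrite subrr powRr0 mulr1.
Qed.

Lemma eGamma_fact n : eGamma n.+1%:R = (n`!%:R : R)%:E.
Proof.
elim: n => [|n IH]; first by rewrite eGamma1.
by rewrite -natr1 eGammaD1// IH -EFinM -natrM.
Qed.

(** For a natural number [N >= s], the bound [t^s <= 1 + t^N] makes the integral at [s + 1] finite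
    by the factorial values; the functional equation carries finiteness down to [s]. *)
Lemma eGamma_lty (s : R) : 0 < s -> (eGamma s < +oo)%E.
Proof.
move=> s0; have [N sN] : exists N : nat, s <= N%:R.
  by exists (Num.bound s); apply: ltW; apply: archi_boundP; exact: ltW.
have : (eGamma (s + 1) < +oo)%E.
  apply: (@le_lt_trans _ _ (eGamma 1 + eGamma (N%:R + 1))%E); last first.
    by rewrite eGamma1 natr1 eGamma_fact -EFinD ltry.
  rewrite -ge0_integralD//; [|exact: measurable_Gamma_integrand..].
  apply: ge0_le_integral => //.
  - exact: measurable_Gamma_integrand.
  - by apply: emeasurable_funD; exact: measurable_Gamma_integrand.
  move=> t; rewrite /= in_itv/= andbT => t0.
  rewrite -EFinD lee_fin -mulrDr ler_wpM2l ?expR_ge0// subrr powRr0 !addrK.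
  have [t1|t1] := leP t 1.
    rewrite (@le_trans _ _ 1)//; last by rewrite lerDl powR_ge0.
    by rewrite -(powRr0 t) ger_powR ?t0// ltW.
  by rewrite (@le_trans _ _ (t `^ N%:R))// ?lerDr// ler_powR// ltW.
rewrite eGammaD1//; case: (eGamma s) (eGamma_ge0 s) => [r _ _|_|//]; first by rewrite ltry.
by rewrite gt0_muley// ltxx.
Qed.

Lemma eGammaE (s : R) : 0 < s -> eGamma s = (Gamma s)%:E.
Proof.
move=> s0; rewrite /Gamma /Rintegral fineK// ge0_fin_numE ?eGamma_lty//.
exact: eGamma_ge0.
Qed.

Lemma GammaD1 (s : R) : 0 < s -> Gamma (s + 1) = s * Gamma s.
Proof.
move=> s0; apply: EFin_inj; rewrite EFinM -!eGammaE// ?eGammaD1//.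
by rewrite addr_gt0.
Qed.

Lemma Gamma_fact n : Gamma n.+1%:R = (n`!%:R : R).
Proof. by apply: EFin_inj; rewrite -eGammaE// eGamma_fact. Qed.

Lemma Gamma_ge0 (s : R) : 0 <= Gamma s.
Proof. exact/fine_ge0/eGamma_ge0. Qed.

(** Weighted arithmetic-geometric mean inequality for [x] and 1. *)
Lemma powR_le_affine (a x : R) : 0 <= a <= 1 -> 0 < x -> x `^ a <= 1 - a + a * x.
Proof.
move=> /andP[a0 a1] x0.
have [y yE] : exists y, y = 1 - a + a * x by eexists.
rewrite -yE.
have y0 : 0 < y.
  have : 0 <= a * x by rewrite mulr_ge0// ltW.
  have [a1E|an1] := eqVneq a 1; first by rewrite yE a1E; lra.
  have : a < 1 by rewrite lt_neqAle an1.
  rewrite yE; lra.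
rewrite /powR gt_eqF// -ler_ln ?posrE ?expR_gt0// expRK.
have H (z : R) : 0 < z -> ln z <= z - 1.
  by move=> z0; have := @le_ln1Dx _ (z - 1); rewrite subrKC; apply; lra.
(* [ln z <= z - 1] is used at [x / y] with weight [a] and at [1 / y] with weight [1 - a]; by the
   choice of [y] the weighted right-hand sides add up to 0. *)
have := H (x / y); rewrite divr_gt0// ln_div ?posrE// => /(_ isT) h1.
have := H (1 / y); rewrite divr_gt0// ln_div ?posrE// ln1 => /(_ isT) h2.
have h3 : a * (ln x - ln y) + (1 - a) * (0 - ln y) <= a * (x / y - 1) + (1 - a) * (1 / y - 1).
  by apply: lerD; apply: ler_wpM2l => //; lra.
have h4 : a * (x / y - 1) + (1 - a) * (1 / y - 1) = 0.
  transitivity ((1 - a + a * x) / y - 1); first by field; rewrite gt_eqF.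
  by rewrite -yE divff ?subrr// gt_eqF.
by rewrite h4 in h3; lra.
Qed.

(* Log-convexity of Gamma between [s] and [s + 1]. *)
Lemma Gamma_le_powR (s a : R) : 0 < s -> 0 <= a <= 1 ->
  Gamma (s + a) <= s `^ a * Gamma s.
Proof.
move=> s0 a01; have /andP[a0 a1] := a01.
(* This integrates [powR_le_affine] at [x = t / s]. As [Gamma (s + 1) = s * Gamma s], the two terms
   on the right then add up to [s^a * Gamma s]. *)
have h : (eGamma (s + a) <= (s `^ a * (1 - a))%:E * eGamma s +
     (s `^ a * a / s)%:E * eGamma (s + 1))%E.
  have c1 : 0 <= s `^ a * (1 - a) by rewrite mulr_ge0 ?powR_ge0// subr_ge0.
  have c2 : 0 <= s `^ a * a / s by rewrite !mulr_ge0 ?powR_ge0// invr_ge0 ltW.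
  have mI (u : R) (k : \bar R) : measurable_fun (`]0, +oo[%classic : set R)
      (fun t : R => k * (expR (- t) * t `^ (u - 1))%:E)%E.
    by apply: measurable_funeM; exact: measurable_Gamma_integrand.
  rewrite -!ge0_integralZl//; [|exact: measurable_Gamma_integrand..].
  rewrite -ge0_integralD//; [|by move=> t _; rewrite mule_ge0|exact: mI|
    by move=> t _; rewrite mule_ge0|exact: mI].
  apply: ge0_le_integral => //.
  - exact: measurable_Gamma_integrand.
  - by apply: emeasurable_funD; exact: mI.
  move=> t; rewrite /= in_itv/= andbT => t0.
  rewrite -!EFinM -EFinD lee_fin.
  have ts : 0 < t / s by rewrite divr_gt0.
  have E1 : t `^ (s + a - 1) = t `^ (s - 1) * (s `^ a * (t / s) `^ a).
    rewrite -powRM ?(ltW s0)//; last exact: ltW.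
    rewrite (_ : s * (t / s) = t); last by field; rewrite gt_eqF.
    rewrite -powRD ?(gt_eqF t0) ?implybT//.
    by congr (_ `^ _); ring.
  have E2 : t `^ (s + 1 - 1) = t `^ (s - 1) * t.
    by rewrite -[X in _ * X]powRr1 ?ltW// -powRD ?(gt_eqF t0) ?implybT//;
      congr (_ `^ _); ring.
  rewrite E1 E2.
  have -> : s `^ a * (1 - a) * (expR (- t) * t `^ (s - 1)) +
     s `^ a * a / s * (expR (- t) * (t `^ (s - 1) * t)) =
     expR (- t) * (t `^ (s - 1) * (s `^ a * (1 - a + a * (t / s)))).
    by field; rewrite gt_eqF.
  do 3 (apply: ler_wpM2l; rewrite ?expR_ge0 ?powR_ge0//).
  exact: powR_le_affine.
rewrite eGammaD1// !eGammaE// in h; last by rewrite ltr_wpDr.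
rewrite -!EFinM -EFinD lee_fin in h.
rewrite (le_trans h)// le_eqVlt; apply/orP; left; apply/eqP.
by field; rewrite gt_eqF.
Qed.

(** If [Gamma s] vanished, log-convexity would force [Gamma] to be nonpositive at the next integer,
    where it is a factorial. *)
Lemma Gamma_gt0 (s : R) : 0 < s -> 0 < Gamma s.
Proof.
move=> s0; rewrite lt_neqAle Gamma_ge0 andbT eq_sym; apply/eqP => G0.
have := archi_boundP (ltW s0); set N := Num.bound s => sN.
have G0' k : Gamma (s + k%:R) = 0.
  elim: k => [|k IH]; first by rewrite addr0.
  by rewrite -natr1 addrA GammaD1 ?IH ?mulr0// ltr_wpDr.
pose m := Num.truncn s.
have /andP[ms sm] : m%:R <= s < m.+1%:R by exact: truncn_itv (ltW s0).
have a01 : 0 <= m.+1%:R - s <= 1.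
  by rewrite subr_ge0 ltW//= lerBlDr -natr1 addrC lerD2l.
have := Gamma_le_powR s0 a01.
rewrite addrC subrK G0 mulr0 Gamma_fact leNgt ltr0n fact_gt0//.
Qed.

End Gamma_integral.

(** * Gaussian moments on the line *)

Section gaussian_moments.
Context {R : realType}.
Local Notation mu := (@lebesgue_measure R).

Lemma ge0_integral_norm (g : R -> \bar R) :
  measurable_fun setT g -> (forall x, (0 <= g x)%E) ->
  (\int[mu]_x g `|x|%R = 2%:E * \int[mu]_(x in `]0%R, +oo[) g x)%E.
Proof.
move=> mg g0.
have mgn : measurable_fun setT (g \o @Num.norm R R) by exact: measurableT_comp.
rewrite -(setUv `]-oo, 0%R]%classic) ge0_integral_setU//=; last 3 first.
- exact: measurableC.
- by rewrite setUv.
- exact/disj_setPCl.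
rewrite (_ : ~` _ = `]0%R, +oo[%classic); last by rewrite setCitvl.
have E1 : (\int[mu]_(x in `]0%R, +oo[) g `|x|%R = \int[mu]_(x in `]0%R, +oo[) g x)%E.
  by apply: eq_integral => x; rewrite inE/= in_itv/= andbT => x0; rewrite gtr0_norm.
have E2 : (\int[mu]_(x in `]-oo, 0%R]) g `|x|%R = \int[mu]_(x in `]0%R, +oo[) g x)%E.
  rewrite integral_itv_obnd_cbnd; last exact: measurable_funTS.
  rewrite ge0_integration_by_substitution0//; apply: eq_integral => x.
  by rewrite inE/= in_itv/= => x0; rewrite ler0_norm.
by rewrite E1 E2 mule_natl mule2n.
Qed.

(** On the half-line, [x^(2b)] integrated over [x^2 < t] gives [t^(b + 1/2) / (2b + 1)]. The
    layer-cake formula then produces [Gamma (b + 3/2)], and the functional equation absorbs the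
    factor [2 / (2b + 1)]. *)
Lemma gaussian_moment (b : R) : - (1 / 2) < b ->
  (\int[mu]_x (`|x| `^ (2 * b) * expR (- x ^+ 2))%:E = (Gamma (b + 1 / 2))%:E)%E.
Proof.
move=> b0; have b1 : 0 < 2 * b + 1 by lra.
have bh : 0 < b + 1 / 2 by lra.
transitivity (\int[mu]_x (`|x| `^ (2 * b) * expR (- `|x| ^+ 2))%:E)%E.
  by apply: eq_integral => x _; rewrite real_normK// num_real.
rewrite (@ge0_integral_norm (fun x => (x `^ (2 * b) * expR (- x ^+ 2))%:E)); last 2 first.
- apply/measurable_EFinP; apply: measurable_funM; first exact: measurable_powR.
  by apply: measurableT_comp => //; apply: measurableT_comp.
- by move=> x; rewrite lee_fin mulr_ge0 ?powR_ge0 ?expR_ge0.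
rewrite (@layer_cake_power _ _ _ mu _ _ _ (b + 1 / 2) ((2 * b + 1)^-1)%:E)//.
- rewrite eGammaD1// eGammaE// -!EFinM; congr (_%:E).
  by field; lra.
- by move=> x; exact: powR_ge0.
- by move=> x _; rewrite sqr_ge0.
- by rewrite lee_fin invr_ge0 ltW.
move=> t t0; rewrite (_ : _ `&` _ = `]0, Num.sqrt t[%classic).
  rewrite (_ : 2 * b = 2 * b + 1 - 1); last by ring.
  rewrite integral_powR// ?sqrtr_gt0// -EFinM mulrC; congr (_ * _)%:E.
    by rewrite addrK.
  rewrite -powR12_sqrt ?ltW// -powRrM; congr (_ `^ _).
  by field.
apply/seteqP; split => x/=; rewrite !in_itv/= andbT.
  by move=> [x0 xt]; rewrite x0 -(ltr_pXn2r (n:=2))// ?nnegrE ?sqrtr_ge0 ?ltW// sqr_sqrtr ?ltW.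
move=> /andP[x0 xt]; split => //.
by rewrite -[ltRHS]sqr_sqrtr ?ltW// ltr_pXn2r// nnegrE ?sqrtr_ge0 ?ltW.
Qed.

(** The moment of order [b = 0] is the Gaussian integral. *)
Lemma Gamma_half : Gamma (1 / 2) = Num.sqrt (pi : R).
Proof.
apply: EFin_inj; rewrite -integralT_gauss -[in LHS](add0r (1 / 2)).
rewrite -gaussian_moment; last by lra.
by apply: eq_integral => x _; rewrite mulr0 powRr0 mul1r.
Qed.

End gaussian_moments.

(** * Stirling's formula *)

Section log_bounds.
Context {R : realType}.
Implicit Types x s u a : R.

Lemma ge0_derive_ge0 (f f' : R -> R) :
  (forall x, 0 <= x -> is_derive x 1 f (f' x)) ->
  (forall x, 0 <= x -> 0 <= f' x) -> f 0 = 0 ->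
  forall x, 0 <= x -> 0 <= f x.
Proof.
move=> df f'0 f0 x x0; rewrite -f0.
apply: (@ger0_derive1_ndecry _ f 0) => //.
- by move=> y; rewrite in_itv/= andbT => /ltW/df[].
- move=> y; rewrite in_itv/= andbT => /ltW y0.
  by have Df := df _ y0; rewrite derive1E derive_val f'0.
- apply: continuous_in_subspaceT => y; rewrite inE/= in_itv/= andbT => y0.
  apply: differentiable_continuous; apply/derivable1_diffP.
  by have [] := df _ y0.
Qed.

Lemma is_derive_ln1D x : 0 <= x ->
  is_derive x 1 (fun y : R => ln (1 + y)) (1 + x)^-1.
Proof.
move=> x0; have x1 : 0 < 1 + x by rewrite ltr_pwDl.
have D1 : is_derive x 1 (fun y : R => 1 + y) 1.
  by apply: is_derive_eq; rewrite /GRing.scale/=; ring.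
have := @is_derive1_comp R (@ln R) (fun y => 1 + y) x _ _ (is_derive1_ln x1) D1.
by rewrite mulr1.
Qed.

(** This is [ln (1 + y) <= y] at [y = - x / (1 + x)], for which [1 + y] is the inverse of
    [1 + x]. *)
Lemma le_divD1_ln1D x : 0 <= x -> x / (1 + x) <= ln (1 + x).
Proof.
move=> x0; have x1 : 0 < 1 + x by rewrite ltr_pwDl.
have := @le_ln1Dx R (- (x / (1 + x))).
have -> : 1 + - (x / (1 + x)) = (1 + x)^-1 by field; rewrite gt_eqF.
rewrite lnV// lerN2; apply.
by rewrite ltrN2 ltr_pdivrMr// mul1r ltrDr.
Qed.

(* Trapezoidal and midpoint estimates of [ln (s + 1) - ln s], the logarithmic
   increment in Stirling's formula. *)
Lemma ln_increment_ge s : 0 < s -> 1 <= (s + 1 / 2) * ln (1 + s^-1).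
Proof.
move=> s0.
(* The derivative is the gap in [le_divD1_ln1D]. The claim follows at [x = s^-1] after
   multiplication by [s / 2]. *)
have : forall x, 0 <= x -> 0 <= (2 + x) * ln (1 + x) - 2 * x.
  apply: (@ge0_derive_ge0 _ (fun x => ln (1 + x) - x / (1 + x))).
  - move=> x x0; have x1 : 0 < 1 + x by rewrite ltr_pwDl.
    have D2 : is_derive x 1 (fun y : R => 2 + y) 1.
      by apply: is_derive_eq; rewrite /GRing.scale/=; ring.
    have D3 : is_derive x 1 (fun y : R => 2 * y) 2.
      by apply: is_derive_eq; rewrite /GRing.scale/=; ring.
    apply: (is_derive_eq (is_deriveB (is_deriveM D2 (is_derive_ln1D x0)) D3)).
    by rewrite /GRing.scale/=; field; rewrite gt_eqF.
  - by move=> x x0; rewrite subr_ge0 le_divD1_ln1D.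
  - by rewrite !(addr0, mulr0, ln1) subr0.
have s'0 : 0 <= s^-1 by rewrite invr_ge0 ltW.
move=> /(_ _ s'0) h.
have := mulr_ge0 (ltW s0) h.
rewrite (_ : s * _ = 2 * ((s + 1 / 2) * ln (1 + s^-1)) - 2); first by lra.
by field; rewrite gt_eqF.
Qed.

Lemma ln_increment_le s : 0 < s ->
  (s + 1 / 2) * ln (1 + s^-1) <= 1 + (s^-1 - (s + 1)^-1) / 4.
Proof.
move=> s0; have s10 : 0 < s + 1 by rewrite ltr_wpDr.
(* The derivative is twice [x - ln (1 + x)]. *)
have : forall x, 0 <= x -> 0 <= (x + 2) * x - (2 + 2 * x) * ln (1 + x).
  apply: (@ge0_derive_ge0 _ (fun x => 2 * (x - ln (1 + x)))).
  - move=> x x0; have x1 : 0 < 1 + x by rewrite ltr_pwDl.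
    have D2 : is_derive x 1 (fun y : R => y + 2) 1.
      by apply: is_derive_eq; rewrite /GRing.scale/=; ring.
    have D3 : is_derive x 1 (fun y : R => 2 + 2 * y) 2.
      by apply: is_derive_eq; rewrite /GRing.scale/=; ring.
    apply: (is_derive_eq (is_deriveB (is_deriveM D2 (is_derive_id x 1))
                                     (is_deriveM D3 (is_derive_ln1D x0)))).
    by rewrite /GRing.scale/=; field; rewrite gt_eqF.
  - move=> x x0; rewrite mulr_ge0// subr_ge0 le_ln1Dx//.
    by rewrite (lt_le_trans _ x0)// ltrN10.
  - by rewrite !(addr0, mulr0, ln1) subr0.
have s'0 : 0 <= s^-1 by rewrite invr_ge0 ltW.
move=> /(_ _ s'0) h.
(* This factor gives the logarithm at [x = s^-1] the coefficient [s + 1 / 2]. *)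
have k0 : 0 <= (s + 1 / 2) * s / (2 * (s + 1)).
  by rewrite divr_ge0// ?mulr_ge0//; lra.
have := mulr_ge0 k0 h.
rewrite [X in 0 <= X](_ : _ =
  1 + (s^-1 - (s + 1)^-1) / 4 - (s + 1 / 2) * ln (1 + s^-1)).
  by rewrite subr_ge0.
by field; rewrite !gt_eqF.
Qed.

End log_bounds.

Section stirling.
Context {R : realType}.
Implicit Types s u a : R.

(** The function [L] of the overview: the ratio of [Gamma s] to [s^(s - 1/2) * e^(-s)]. *)
Definition stirling s : R := Gamma s * expR s * s `^ (1 / 2 - s).

Definition Gamma_quot a s : R := Gamma (s + a) / (s `^ a * Gamma s).

Lemma stirling_gt0 s : 0 < s -> 0 < stirling s.
Proof.
by move=> s0; rewrite /stirling !mulr_gt0 ?Gamma_gt0 ?expR_gt0 ?powR_gt0.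
Qed.

(** Exact identity separating the effect of a shift into a Gamma quotient and an elementary factor;
    it serves for unit steps and for fractional shifts. *)
Lemma stirlingD s a : 0 < s -> 0 <= a ->
  stirling (s + a) =
  stirling s * Gamma_quot a s * expR (a - (s + a - 1 / 2) * ln (1 + a / s)).
Proof.
move=> s0 a0; have sa0 : 0 < s + a by rewrite ltr_wpDr.
have G0 := Gamma_gt0 s0.
rewrite /stirling /Gamma_quot /powR !gt_eqF//.
have -> : 1 + a / s = (s + a) / s by field; rewrite gt_eqF.
rewrite ln_div ?posrE//.
transitivity (Gamma (s + a) * (expR (s + a) * expR ((1 / 2 - (s + a)) * ln (s + a)))).
  by rewrite mulrA.
rewrite -expRD.
transitivity (Gamma (s + a) * (expR s * expR ((1 / 2 - s) * ln s) / expR (a * ln s) *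
   expR (a - (s + a - 1 / 2) * (ln (s + a) - ln s)))).
  by rewrite -expRD -expRN -!expRD; congr (_ * expR _); ring.
by field; rewrite !gt_eqF ?expR_gt0.
Qed.

Lemma Gamma_quot1 s : 0 < s -> Gamma_quot 1 s = 1.
Proof.
move=> s0; rewrite /Gamma_quot GammaD1// powRr1 ?ltW// divff//.
by rewrite mulf_neq0 ?gt_eqF ?Gamma_gt0.
Qed.

Lemma stirling_step s : 0 < s ->
  stirling s = stirling (s + 1) * expR ((s + 1 / 2) * ln (1 + s^-1) - 1).
Proof.
move=> s0; rewrite stirlingD// Gamma_quot1// mulr1 (div1r s) -mulrA -expRD.
by rewrite [X in expR X](_ : _ = 0) ?expR0 ?mulr1//; move: (ln _) => l; field.
Qed.

Lemma stirling_decr s : 0 < s -> stirling (s + 1) <= stirling s.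
Proof.
move=> s0; rewrite [leRHS]stirling_step// ler_peMr//.
  by rewrite ltW// stirling_gt0// addr_gt0.
by rewrite -[leLHS]expR0 ler_expR subr_ge0 ln_increment_ge.
Qed.

(** The error of the trapezoidal estimate telescopes, so a factor [e^(-1/(4s))] turns the decrease
    along unit steps into an increase. *)
Lemma stirling_incr s : 0 < s ->
  stirling s * expR (- (s^-1 / 4)) <=
  stirling (s + 1) * expR (- ((s + 1)^-1 / 4)).
Proof.
move=> s0; rewrite stirling_step// -mulrA ler_pM2l ?stirling_gt0 ?addr_gt0//.
by rewrite -expRD ler_expR; have := ln_increment_le s0; lra.
Qed.

Lemma Gamma_quot_le1 s a : 0 < s -> 0 <= a <= 1 -> Gamma_quot a s <= 1.
Proof.
move=> s0 a01; rewrite /Gamma_quot ler_pdivrMr ?mul1r; first exact: Gamma_le_powR.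
by rewrite mulr_gt0 ?powR_gt0 ?Gamma_gt0.
Qed.

(** Log-convexity from [s + a] up to [s + 1] gives [s * Gamma s <= (s + a)^(1 - a) * Gamma (s + a)],
    and [s^a * (s + a)^(1 - a) <= s + 1]. *)
Lemma Gamma_quot_ge s a : 0 < s -> 0 <= a <= 1 -> s / (s + 1) <= Gamma_quot a s.
Proof.
move=> s0 a01; have /andP[a0 a1] := a01.
have sa0 : 0 < s + a by rewrite ltr_wpDr.
have s10 : 0 < s + 1 by rewrite ltr_wpDr.
have b01 : 0 <= 1 - a <= 1 by rewrite subr_ge0 a1 lerBlDr lerDl.
have := Gamma_le_powR sa0 b01.
rewrite -addrA subrKC GammaD1// => h.
rewrite /Gamma_quot ler_pdivlMr ?mulr_gt0 ?powR_gt0 ?Gamma_gt0//.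
apply: (@le_trans _ _ (s `^ a / (s + 1) * ((s + a) `^ (1 - a) * Gamma (s + a)))).
  rewrite (_ : s / _ * _ = s `^ a / (s + 1) * (s * Gamma s)); last by ring.
  by rewrite ler_wpM2l// divr_ge0 ?powR_ge0// ltW.
rewrite mulrA ler_piMl ?Gamma_ge0// mulrAC ler_pdivrMr// mul1r.
apply: (@le_trans _ _ ((s + 1) `^ a * (s + 1) `^ (1 - a))).
  by clear h; apply: ler_pM; rewrite ?powR_ge0//; apply: ge0_ler_powR;
    rewrite ?nnegrE ?subr_ge0//; lra.
by rewrite -powRD ?(gt_eqF s10) ?implybT// subrKC powRr1 // (ltW s10).
Qed.

Lemma cvgV_pinfty : s^-1 @[s --> +oo] --> (0 : R).
Proof.
apply/(@gtr0_cvgV0 _ _ _ _ (fun s : R => s)) => //.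
exact: nbhs_pinfty_gt.
Qed.

Lemma cvg_div_D1_pinfty : s / (s + 1) @[s --> +oo] --> (1 : R).
Proof.
apply: (@squeeze_cvgr _ _ _ _ (fun s : R => 1 - s^-1) (fun=> 1)).
- near=> s.
  have s0 : 0 < s by near: s; exact: nbhs_pinfty_gt.
  have s10 : 0 < s + 1 by rewrite ltr_wpDr.
  rewrite ler_pdivrMr// mul1r lerDl ler01 andbT ler_pdivlMr//.
  rewrite (_ : (1 - s^-1) * (s + 1) = s - s^-1); last by field; rewrite gt_eqF.
  by rewrite gerBl invr_ge0 ltW.
- rewrite -[X in _ --> X](subr0 1); apply: cvgB; first exact: cvg_cst.
  exact: cvgV_pinfty.
- exact: cvg_cst.
Unshelve. all: end_near. Qed.

Lemma cvg_Gamma_quot01 a : 0 <= a <= 1 -> Gamma_quot a s @[s --> +oo] --> (1 : R).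
Proof.
move=> a01.
apply: (@squeeze_cvgr _ _ _ _ (fun s : R => s / (s + 1)) (fun=> 1)).
- near=> s.
  have s0 : 0 < s by near: s; exact: nbhs_pinfty_gt.
  by rewrite Gamma_quot_le1// Gamma_quot_ge.
- exact: cvg_div_D1_pinfty.
- exact: cvg_cst.
Unshelve. all: end_near. Qed.

Lemma Gamma_quotD1 a s : 0 < s -> 0 <= a ->
  Gamma_quot (a + 1) s = Gamma_quot a s * (1 + a / s).
Proof.
move=> s0 a0; have sa0 : 0 < s + a by rewrite ltr_wpDr.
rewrite /Gamma_quot addrA GammaD1// powRD ?(gt_eqF s0) ?implybT// powRr1 ?ltW//.
by field; rewrite !gt_eqF ?Gamma_gt0 ?powR_gt0.
Qed.

(** Induction on the integer part of [a]: lowering [a] by 1 costs a factor [1 + (a - 1) / s], which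
    tends to 1. *)
Lemma cvg_Gamma_quot a : 0 <= a -> Gamma_quot a s @[s --> +oo] --> (1 : R).
Proof.
move=> a0; have /andP[] := truncn_itv a0.
move: (Num.truncn a) => k.
elim: k a a0 => [|k IH] a a0 ka ak.
  by apply: cvg_Gamma_quot01; rewrite a0 ltW.
have a1 : 0 <= a - 1.
  by rewrite subr_ge0 (le_trans _ ka)// ler1n.
have := IH _ a1; rewrite lerBrDr natr1 ka ltrBlDr natr1 ak => /(_ isT isT) h.
have {}h : Gamma_quot (a - 1) s * (1 + (a - 1) * s^-1) @[s --> +oo] --> (1 : R).
  rewrite -[X in _ --> X](mulr1 1); apply: cvgM => //.
  rewrite -[X in _ --> X](addr0 1); apply: cvgD; first exact: cvg_cst.
  by rewrite -[X in _ --> X](mulr0 (a - 1)); apply: cvgMr; exact: cvgV_pinfty.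
apply: cvg_trans h; apply: near_eq_cvg; near=> s.
have s0 : 0 < s by near: s; exact: nbhs_pinfty_gt.
by rewrite -Gamma_quotD1// subrK.
Unshelve. all: end_near. Qed.

Lemma cvg_stirling_nat : exists2 C : R, 0 < C & stirling n%:R @[n --> \oo] --> C.
Proof.
have st n : 0 < n.+1%:R :> R by [].
have decr : nonincreasing_seq (fun n => stirling n.+1%:R).
  by apply/nonincreasing_seqP => n; rewrite -[in leLHS]natr1 stirling_decr.
have incr : nondecreasing_seq (fun n : nat => stirling n.+1%:R * expR (- (n.+1%:R^-1 / 4))).
  by apply/nondecreasing_seqP => n; rewrite -[n.+2%:R]natr1 stirling_incr.
(* The first term of the increasing corrected sequence: a positive lower bound for the decreasing
   one, so the limit cannot be 0. *)
pose m := stirling 1 * expR (- (1^-1 / 4)).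
have m0 : 0 < m by rewrite mulr_gt0 ?expR_gt0 ?stirling_gt0.
have mle n : m <= stirling n.+1%:R.
  apply: (le_trans (incr 0%N n (leq0n n))).
  by rewrite ler_piMr ?(ltW (stirling_gt0 _))// -[leRHS]expR0 ler_expR oppr_le0.
have cv : cvgn (fun n => stirling n.+1%:R).
  apply: nonincreasing_is_cvgn => //.
  by exists m => _ [n _ <-].
exists (limn (fun n => stirling n.+1%:R)).
  by rewrite (lt_le_trans m0)// limr_ge//; exact: nearW.
by rewrite -cvg_shiftS.
Qed.

(* The values at consecutive integers control those in between because
   [Gamma_quot a] is close to 1 uniformly in [a] between 0 and 1. *)
Lemma stirling_interp u a : 1 <= u -> 0 <= a <= 1 ->
  stirling u * (u / (u + 1)) * expR (- u^-1) <= stirling (u + a) <=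
  stirling u * expR u^-1.
Proof.
move=> u1 a01; have /andP[a0 a1] := a01.
have u0 : 0 < u by exact: lt_le_trans u1.
have ua0 : 0 < u + a by rewrite ltr_wpDr.
have au : 0 <= a / u by rewrite divr_ge0// ltW.
have h1 := le_divD1_ln1D au.
have h2 : ln (1 + a / u) <= a / u by apply: le_ln1Dx; exact: lt_le_trans au.
(* Since [1 <= u], this factor is nonnegative and may multiply both bounds of the logarithm. *)
have c0 : 0 <= u + a - 1 / 2 by lra.
have u'0 : 0 < u^-1 by rewrite invr_gt0.
have Q1 := Gamma_quot_le1 u0 a01.
have Q0 := Gamma_quot_ge u0 a01.
have S0 := stirling_gt0 u0.
have E1 : - u^-1 <= a - (u + a - 1 / 2) * ln (1 + a / u).
  have := ler_wpM2l c0 h2.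
  have -> : (u + a - 1 / 2) * (a / u) = a + a * (a - 1 / 2) * u^-1.
    by field; rewrite gt_eqF.
  have : a * (a - 1 / 2) * u^-1 <= 1 * u^-1 by rewrite ler_pM2r//; nra.
  lra.
have E2 : a - (u + a - 1 / 2) * ln (1 + a / u) <= u^-1.
  have := ler_wpM2l c0 h1.
  have -> : (u + a - 1 / 2) * (a / u / (1 + a / u)) = a - a / 2 * (u + a)^-1.
    by field; rewrite !gt_eqF.
  have : (u + a)^-1 <= u^-1 by rewrite lef_pV2 ?posrE// lerDl.
  have := ltW u'0.
  nra.
rewrite stirlingD//; apply/andP; split.
  apply: ler_pM; rewrite ?expR_ge0 ?ler_expR//.
    by rewrite mulr_ge0 ?divr_ge0// ltW//; lra.
  by rewrite ler_pM2l.
apply: ler_pM; rewrite ?expR_ge0 ?ler_expR//.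
  rewrite mulr_ge0 ?(ltW S0)// (le_trans _ Q0)// divr_ge0//; lra.
by rewrite ler_piMr// ltW.
Qed.

Lemma cvg_truncn_pinfty : Num.truncn s @[s --> (+oo : set_system R)] --> \oo.
Proof.
apply/(@cvgrnyP R); apply/cvgryPge => A.
near=> s.
have s0 : 0 <= s by near: s; exact: nbhs_pinfty_ge.
have /andP[_] := truncn_itv s0.
rewrite -natr1 => h.
have : A + 1 <= s by near: s; by apply: nbhs_pinfty_ge; exact: num_real.
by move=> h'; rewrite -(lerD2r 1) (le_trans h')// ltW.
Unshelve. all: end_near. Qed.

(** Squeeze: [stirling_interp] at the integer part [u] of [s] with [a = s - u]. *)
Lemma cvg_stirling_lim (C : R) : stirling n%:R @[n --> \oo] --> C ->
  stirling s @[s --> +oo] --> C.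
Proof.
move=> hC.
have V : (n%:R^-1 : R) @[n --> \oo] --> 0.
  exact: (cvg_comp _ _ (@cvgr_idn R) cvgV_pinfty).
have Q : (n%:R / (n%:R + 1) : R) @[n --> \oo] --> (1 : R).
  exact: (cvg_comp _ _ (@cvgr_idn R) cvg_div_D1_pinfty).
have lo : stirling n%:R * (n%:R / (n%:R + 1)) * expR (- n%:R^-1) @[n --> \oo] --> C.
  rewrite [X in _ --> X](_ : C = C * 1 * 1); last by rewrite !mulr1.
  apply: cvgM; first exact: cvgM.
  have := @continuous_cvg _ _ _ _ _ _ (@expR R) _ (@continuous_expR R _) (cvgN V).
  by rewrite oppr0 expR0; apply.
have hi : stirling n%:R * expR (n%:R^-1) @[n --> \oo] --> C.
  rewrite -[X in _ --> X]mulr1; apply: cvgM => //.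
  have := @continuous_cvg _ _ _ _ _ _ (@expR R) _ (@continuous_expR R _) V.
  by rewrite expR0; apply.
have lo' := cvg_comp _ _ cvg_truncn_pinfty lo.
have hi' := cvg_comp _ _ cvg_truncn_pinfty hi.
apply: squeeze_cvgr lo' hi'.
near=> s => /=.
have s1 : 1 <= s by near: s; exact: nbhs_pinfty_ge.
have s0 : 0 <= s by exact: le_trans s1.
have /andP[h1 h2] := truncn_itv s0.
set u : R := (Num.truncn s)%:R in h1 *.
have u1 : 1 <= u by rewrite ler1n truncn_gt0.
have := @stirling_interp u (s - u) u1.
rewrite subrKC; apply.
by rewrite subr_ge0 h1 lerBlDr addrC /u natr1 ltW.
Unshelve. all: end_near. Qed.

(** Legendre's formula at positive integers [u], by induction: passing to [u + 1] multiplies both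
    sides by [2u * (2u + 1) = 4 * u * (u + 1/2)]. *)
Lemma Gamma_duplication n :
  Gamma (2 * n.+1%:R) * Num.sqrt pi =
  2 `^ (2 * n.+1%:R - 1) * Gamma n.+1%:R * Gamma (n.+1%:R + 1 / 2) :> R.
Proof.
elim: n => [|n IH].
  have -> : Gamma (1 + 1 / 2) = 1 / 2 * Num.sqrt pi :> R.
    by rewrite (addrC 1) GammaD1 ?Gamma_half//; lra.
  have -> : Gamma (2 * 1) = 1 :> R by rewrite mulr1 (Gamma_fact 1).
  have -> : Gamma 1 = 1 :> R by rewrite (Gamma_fact 0).
  have -> : 2 * 1 - 1 = 1 :> R by ring.
  by rewrite powRr1//; field.
have n0 : (0 : R) < n.+1%:R by [].
move: (n.+1%:R : R) n0 (natr1 (R:=R) n.+1) IH => u u0 <-.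
have [v0 w0 h0] : [/\ 0 < 2 * u, 0 < 2 * u + 1 & 0 < u + 1 / 2] by split; lra.
move=> IH.
have -> : 2 * (u + 1) = 2 * u + 1 + 1 by ring.
have -> : u + 1 + 1 / 2 = u + 1 / 2 + 1 by ring.
have -> : 2 * u + 1 + 1 - 1 = 2 * u - 1 + 1 + 1 by ring.
rewrite (GammaD1 w0) (GammaD1 v0) (GammaD1 u0) (GammaD1 h0).
rewrite -!mulrA IH.
rewrite !powRD ?pnatr_eq0 ?implybT// powRr1//.
by field.
Qed.

(** The duplication formula in terms of [stirling]; in the limit it becomes an equation for the
    unknown constant. *)
Lemma stirling_double n : stirling (2 * n.+1%:R) * Num.sqrt (2 * pi) =
  Gamma_quot (1 / 2) n.+1%:R * stirling n.+1%:R ^+ 2.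
Proof.
have := Gamma_duplication n.
have n0 : (0 : R) < n.+1%:R by [].
move: (n.+1%:R : R) n0 => u u0 D.
have p0 : 0 < Num.sqrt (pi : R) by rewrite sqrtr_gt0 pi_gt0.
have -> : Num.sqrt (2 * pi) = 2 `^ (1 / 2) * Num.sqrt pi :> R.
  by rewrite sqrtrM// -powR12_sqrt// div1r.
rewrite /stirling /Gamma_quot.
have -> : Gamma (2 * u) = 2 `^ (2 * u - 1) * Gamma u * Gamma (u + 1 / 2) / Num.sqrt pi.
  by apply: (canRL (mulfK _)); rewrite ?gt_eqF.
have Gu := Gamma_gt0 u0.
have -> : expR (2 * u) = expR u * expR u by rewrite -expRD; congr expR; ring.
(* Powers of [u] and of 2 are collected by hand, because [field] treats real powers as atoms. *)
have E1 : (2 * u) `^ (1 / 2 - 2 * u) * u `^ (1 / 2) =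
    2 `^ (1 / 2 - 2 * u) * u `^ (1 / 2 - u) ^+ 2.
  rewrite powRM ?ltW// -mulrA; congr (_ * _).
  rewrite expr2 -!powRD ?(gt_eqF u0) ?implybT//.
  by congr (_ `^ _); ring.
have E2 : 2 `^ (2 * u - 1) * 2 `^ (1 / 2 - 2 * u) * 2 `^ (1 / 2) = 1 :> R.
  rewrite -!powRD ?pnatr_eq0 ?implybT//.
  by rewrite [X in 2 `^ X](_ : _ = 0) ?powRr0//; field.
have u2 : 0 < u `^ (1 / 2) by rewrite powR_gt0.
transitivity (2 `^ (2 * u - 1) * ((2 * u) `^ (1 / 2 - 2 * u) * u `^ (1 / 2)) * 2 `^ (1 / 2) *
   (Gamma u * Gamma (u + 1 / 2) * expR u * expR u / u `^ (1 / 2))).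
  by field; rewrite !gt_eqF.
rewrite E1.
transitivity ((2 `^ (2 * u - 1) * 2 `^ (1 / 2 - 2 * u) * 2 `^ (1 / 2)) *
   (u `^ (1 / 2 - u) ^+ 2 * Gamma u * Gamma (u + 1 / 2) * expR u * expR u / u `^ (1 / 2))).
  by field; rewrite !gt_eqF.
by rewrite E2; field; rewrite !gt_eqF.
Qed.

Lemma cvg_stirling : stirling s @[s --> +oo] --> (Num.sqrt (2 * pi) : R).
Proof.
have [C C0 hC] := cvg_stirling_nat.
have H := cvg_stirling_lim hC.
suff -> : Num.sqrt (2 * pi) = C by [].
have Sn : (n.+1%:R : R) @[n --> \oo] --> +oo.
  apply/cvgryPge => A; near=> n; apply: (@le_trans _ _ n%:R).
    by near: n; exact: nbhs_infty_ger.
  by rewrite ler_nat.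
have L1 : stirling (2 * n.+1%:R) * Num.sqrt (2 * pi) @[n --> \oo] --> C * Num.sqrt (2 * pi).
  apply: cvgMl; apply: (cvg_comp (fun n => 2 * n.+1%:R) _ _ H).
  apply: (cvg_comp _ ( *%R 2) Sn).
  by apply: (@gt0_cvgMry _ _ _ 2 id) => //; exact: cvg_id.
have L2 : stirling (2 * n.+1%:R) * Num.sqrt (2 * pi) @[n --> \oo] --> 1 * C ^+ 2.
  under eq_cvg do rewrite stirling_double.
  have h12 : 0 <= 1 / 2 :> R by [].
  apply: cvgM; first exact: (cvg_comp _ _ Sn (cvg_Gamma_quot h12)).
  rewrite expr2; under eq_cvg do rewrite expr2.
  by apply: cvgM; exact: (cvg_comp _ _ Sn H).
(* Both sides of [stirling_double] converge; as [C] is nonzero, it cancels. *)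
have : C * Num.sqrt (2 * pi) = 1 * C ^+ 2.
  by apply: (cvg_unique _ L1 L2); exact: Rhausdorff.
rewrite mul1r expr2 => /mulfI; apply.
by rewrite gt_eqF.
Unshelve. all: end_near. Qed.

(** Stirling's formula with a fixed shift: [a = 1/2] serves for the factors [Gamma (b_k + 1/2)], and
    [a = 1 + n/2] for the denominator. *)
Lemma cvg_Gamma_stirling a : 0 <= a ->
  Gamma (s + a) / (Num.sqrt (2 * pi) * expR (- s) * s `^ (s + a - 1 / 2))
    @[s --> +oo] --> (1 : R).
Proof.
move=> a0.
have p0 : 0 < Num.sqrt (2 * pi : R) by rewrite sqrtr_gt0 mulr_gt0 ?pi_gt0.
have h : Gamma_quot a s * stirling s / Num.sqrt (2 * pi) @[s --> +oo] --> (1 : R).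
  rewrite [X in _ --> X](_ : 1 = 1 * Num.sqrt (2 * pi) / Num.sqrt (2 * pi)).
    apply: cvgMl; apply: cvgM; [exact: cvg_Gamma_quot|exact: cvg_stirling].
  by rewrite mul1r divff ?gt_eqF.
apply: cvg_trans h; apply: near_eq_cvg; near=> s.
have s0 : 0 < s by near: s; exact: nbhs_pinfty_gt.
have Gs := Gamma_gt0 s0.
rewrite /stirling /Gamma_quot expRN.
have -> : s `^ (s + a - 1 / 2) = s `^ a / s `^ (1 / 2 - s).
  by rewrite -powRN -powRD ?(gt_eqF s0) ?implybT//; congr (_ `^ _); ring.
by field; rewrite !gt_eqF ?powR_gt0 ?expR_gt0.
Unshelve. all: end_near. Qed.

End stirling.

(** * Integrals over the unit ball *)

Section ball_integral.
Context {R : realType} {n : nat}.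
Local Notation Rn := (n.-tuple (measurableTypeR R)).
Implicit Types (b : 'I_n -> R) (x : Rn).

Lemma powR_sum (c : R) (I : Type) (r : seq I) (P : pred I) (F : I -> R) : 0 < c ->
  c `^ (\sum_(i <- r | P i) F i) = \prod_(i <- r | P i) c `^ F i.
Proof.
move=> c0; elim/big_rec2 : _ => [|i y z _ <-]; first by rewrite powRr0.
by rewrite powRD// (gt_eqF c0) implybT.
Qed.

Lemma enorm_sqr x : enorm x ^+ 2 = \sum_(k < n) tnth x k ^+ 2.
Proof. by rewrite /enorm sqr_sqrtr// sumr_ge0// => k _; exact: sqr_ge0. Qed.

Lemma measurable_enorm_sqr : measurable_fun setT (fun x => enorm x ^+ 2).
Proof.
under eq_fun do rewrite enorm_sqr.
apply: measurable_sum => k.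
by apply: measurable_funX; exact: measurable_tnth.
Qed.

Lemma measurable_norm_powR (c : R) :
  measurable_fun setT (fun x : measurableTypeR R => `|x| `^ c : R).
Proof. exact: (measurableT_comp (measurable_powR c)). Qed.

Lemma measurable_monomial2 b : measurable_fun setT (monomial2 b : Rn -> R).
Proof.
apply: (measurable_tuple_prod (h := fun k (x : measurableTypeR R) => `|x| `^ (2 * b k))) => k.
exact: measurable_norm_powR.
Qed.

Lemma monomial2_ge0 b x : 0 <= monomial2 b x.
Proof. by apply: prodr_ge0 => k _; exact: powR_ge0. Qed.

Lemma unit_ballE : unit_ball = [set x : Rn | enorm x ^+ 2 < 1].
Proof.
apply/seteqP; split => x; rewrite /unit_ball/= -[X in _ ^+ 2 < X](expr1n R 2).
  by rewrite ltr_pXn2r// nnegrE// sqrtr_ge0.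
by rewrite ltr_pXn2r// nnegrE// sqrtr_ge0.
Qed.

Lemma measurable_enorm_sqr_lt (t : R) : measurable [set x : Rn | enorm x ^+ 2 < t].
Proof. by apply: measurable_set_lt => //; exact: measurable_enorm_sqr. Qed.

(** Homogeneity: scaling by [c = sqrt t] gives [c^n] from the measure and [c^(2|b|)] from the
    monomial. *)
Lemma integral_ball_scale b (t : R) : 0 < t ->
  (\int[lebesgue_tuple R n]_(x in [set x | enorm x ^+ 2 < t]%R) (monomial2 b x)%:E =
   \int[lebesgue_tuple R n]_(x in unit_ball) (monomial2 b x)%:E *
     (t `^ (multi_sum b + n%:R / 2))%:E)%E.
Proof.
move=> t0; set c := Num.sqrt t.
have c0 : 0 < c by rewrite sqrtr_gt0.
have c2 : c ^+ 2 = t by rewrite sqr_sqrtr// ltW.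
have mm D : measurable_fun D (fun x : Rn => (monomial2 b x)%:E).
  by apply: measurable_funTS; apply/measurable_EFinP; exact: measurable_monomial2.
rewrite integral_mkcond (ge0_integral_tuple_scale c0); last 2 first.
- by apply/(measurable_restrictT _ _).1 => //; exact: measurable_enorm_sqr_lt.
- by move=> x; apply: erestrict_ge0 => y _; rewrite lee_fin monomial2_ge0.
transitivity ((c ^+ n)%:E * \int[lebesgue_tuple R n]_(x in unit_ball)
   ((c `^ (2 * multi_sum b))%:E * (monomial2 b x)%:E))%E.
  congr (_ * _)%E; rewrite [RHS]integral_mkcond; apply: eq_integral => x _.
  have nE : enorm (map_tuple ( *%R c) x : Rn) ^+ 2 = t * enorm x ^+ 2.
    rewrite !enorm_sqr mulr_sumr; apply: eq_bigr => k _.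
    by rewrite tnth_map exprMn c2.
  have mE : monomial2 b (map_tuple ( *%R c) x : Rn) =
      c `^ (2 * multi_sum b) * monomial2 b x.
    rewrite /multi_sum mulr_sumr powR_sum// -big_split/=; apply: eq_bigr => k _.
    by rewrite tnth_map normrM powRM// gtr0_norm.
  rewrite unit_ballE !patchE.
  have -> : (map_tuple ( *%R c) x \in [set y : Rn | enorm y ^+ 2 < t]) =
            (x \in [set y : Rn | enorm y ^+ 2 < 1]).
    apply/idP/idP; rewrite !inE/= nE; first by rewrite gtr_pMr.
    by rewrite gtr_pMr.
  by case: ifP => // _; rewrite mE EFinM.
rewrite ge0_integralZl//; last 3 first.
- by rewrite unit_ballE; exact: measurable_enorm_sqr_lt.
- by move=> x _; rewrite lee_fin monomial2_ge0.
- by rewrite lee_fin powR_ge0.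
rewrite muleA muleC -EFinM; congr (_ * _%:E)%E.
rewrite -powR_mulrn ?ltW// -powRD ?(gt_eqF c0) ?implybT//.
rewrite /c -powR12_sqrt ?ltW// -powRrM; congr (_ `^ _).
by field.
Qed.

Lemma gaussian_monomial2 b : (forall k, - (1 / 2) < b k) ->
  (\int[lebesgue_tuple R n]_x (monomial2 b x * expR (- enorm x ^+ 2))%:E =
   (\prod_(k < n) Gamma (b k + 1 / 2))%:E)%E.
Proof.
move=> hb.
transitivity (\int[lebesgue_tuple R n]_x
    (\prod_(k < n) (`|tnth x k| `^ (2 * b k) * expR (- tnth x k ^+ 2)))%:E)%E.
  apply: eq_integral => x _; congr (_%:E).
  by rewrite enorm_sqr -sumrN expR_sum -big_split.
have mh k : measurable_fun setT (fun x : measurableTypeR R =>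
    `|x| `^ (2 * b k) * expR (- x ^+ 2) : R).
  apply: measurable_funM; first exact: measurable_norm_powR.
  by apply: measurableT_comp => //; apply: measurableT_comp.
rewrite (ge0_integral_tuple_prod lebesgue_measure mh); last first.
  by move=> k x; rewrite mulr_ge0 ?powR_ge0 ?expR_ge0.
by rewrite -prodEFin; apply: eq_bigr => k _; rewrite gaussian_moment.
Qed.

Lemma multi_sum_gt b : (forall k, - (1 / 2) < b k) -> 0 < multi_sum b + 1 + n%:R / 2.
Proof.
move=> hb; rewrite addrAC ltr_wpDl//.
rewrite (_ : _ + _ = \sum_(k < n) (b k + 1 / 2)).
  by apply: sumr_ge0 => k _; have := hb k; lra.
by rewrite big_split/= sumr_const card_ord -[(1 / 2) *+ n]mulr_natl div1r.
Qed.

(** The Gaussian moment is computed twice, as a product and by slicing into balls. The comparison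
    takes place in the extended reals, so finiteness of the integral comes with its value. *)
Lemma integral_ball b : (forall k, - (1 / 2) < b k) ->
  (\int[lebesgue_tuple R n]_(x in unit_ball) (monomial2 b x)%:E =
   (1 / Gamma (multi_sum b + 1 + n%:R / 2) *
      \prod_(k < n) Gamma (b k + 1 / 2))%:E)%E.
Proof.
move=> hb; have S0 := multi_sum_gt hb; have G0 := Gamma_gt0 S0.
set I := (X in X = _).
have I0 : (0 <= I)%E by apply: integral_ge0 => x _; rewrite lee_fin monomial2_ge0.
have E : ((\prod_(k < n) Gamma (b k + 1 / 2))%:E =
    I * (Gamma (multi_sum b + 1 + n%:R / 2))%:E)%E.
  rewrite -gaussian_monomial2// -eGammaE// addrAC.
  apply: layer_cake_power => //.
  - exact: measurable_monomial2.
  - exact: measurable_enorm_sqr.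
  - exact: monomial2_ge0.
  - by move=> x _; exact: sqr_ge0.
  - by move=> t t0; rewrite setTI; exact: integral_ball_scale.
rewrite mulrC EFinM E -muleA -EFinM div1r mulfV ?gt_eqF// mule1//.
Qed.

End ball_integral.

(** * Moments with integer exponents *)

Section integer_exponents.
Context {R : realType}.

Lemma Gamma_nat_half a : Gamma (a%:R + 1 / 2) =
  (double_fact (2 * a - 1))%:R / 2 ^+ a * Num.sqrt pi :> R.
Proof.
(* At [a = 0] the truncated difference [2 * 0 - 1] is 0, and [double_fact 0] is 1. *)
elim: a => [|a IH]; first by rewrite add0r Gamma_half expr0 divr1 mul1r.
rewrite -natr1 addrAC GammaD1 ?ltr_wpDl// IH.
have -> : double_fact (2 * a.+1 - 1) = ((2 * a).+1 * double_fact (2 * a - 1))%N.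
  case: a {IH} => // a.
  by rewrite !mulnS !addSn !add0n !subn1 /= .
rewrite natrM -[(2 * a).+1%:R]natr1 natrM exprS.
by field; rewrite expf_neq0// pnatr_eq0.
Qed.

(** The functional equation iterated [N] times, with a 2 put into each factor; at [c = n/2] the
    factors are [n + 2j]. *)
Lemma Gamma_natD (c : R) N : 0 < c -> Gamma (N%:R + c + 1) * 2 ^+ N =
  (\prod_(1 <= j < N.+1) (2 * c + 2 * j%:R)) * Gamma (c + 1).
Proof.
move=> c0; elim: N => [|N IH].
  by rewrite add0r expr0 mulr1 big_geq// mul1r.
rewrite big_nat_recr//= mulrAC -IH -natr1.
rewrite (_ : N%:R + 1 + c + 1 = N%:R + c + 1 + 1); last by ring.
rewrite GammaD1; last by rewrite addr_gt0// ltr_wpDl.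
by rewrite exprS -natr1; ring.
Qed.

Lemma powR_half_nat (p : R) n : 0 <= p -> p `^ (n%:R / 2) = Num.sqrt p ^+ n.
Proof.
move=> p0; rewrite mulrC powRrM powR12_sqrt// powR_mulrn// sqrtr_ge0.
Qed.

End integer_exponents.

Section integer_moments.
Context {R : realType}.

Lemma ball_volumeE n : (0 < n)%N ->
  ball_volume n = Num.sqrt (pi : R) ^+ n / Gamma (n%:R / 2 + 1).
Proof.
move=> n0; have n0' : 0 < n%:R :> R by rewrite ltr0n.
have n2 : 0 < n%:R / 2 :> R by rewrite divr_gt0.
rewrite /ball_volume /sphere_area powR_half_nat ?pi_ge0// GammaD1//.
by field; rewrite !gt_eqF ?Gamma_gt0.
Qed.

(** The powers of [sqrt pi] cancel against the volume, and the powers of 2 from the half-integer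
    values against those of [Gamma_natD]. *)
Lemma mean_monomial2_nat n (a : 'I_n -> nat) : (0 < n)%N ->
  1 / ball_volume n *
    (1 / Gamma (\sum_(k < n) (a k)%:R + 1 + n%:R / 2) *
     \prod_(k < n) Gamma ((a k)%:R + 1 / 2)) =
  (\prod_(k < n | a k != 0%N) double_fact (2 * a k - 1))%N%:R /
  (\prod_(1 <= j < (\sum_(k < n) a k).+1) (n + 2 * j))%N%:R :> R.
Proof.
move=> n0; have n0' : 0 < n%:R :> R by rewrite ltr0n.
have n2 : 0 < n%:R / 2 :> R by rewrite divr_gt0.
have sp : 0 < Num.sqrt (pi : R) by rewrite sqrtr_gt0 pi_gt0.
rewrite ball_volumeE//.
have -> : \prod_(k < n) Gamma ((a k)%:R + 1 / 2) =
    (\prod_(k < n) (double_fact (2 * a k - 1))%:R) / 2 ^+ (\sum_(k < n) a k) *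
    Num.sqrt pi ^+ n :> R.
  transitivity (\prod_(k < n)
    ((double_fact (2 * a k - 1))%:R * (2 ^+ a k)^-1 * Num.sqrt pi) : R).
    by apply: eq_bigr => k _; rewrite Gamma_nat_half.
  by rewrite !big_split/= prodr_const card_ord prodfV -expr_sum.
(* The factors left out at [a k = 0] equal 1. *)
have -> : (\prod_(k < n | a k != 0%N) double_fact (2 * a k - 1))%N =
    (\prod_(k < n) double_fact (2 * a k - 1))%N.
  rewrite big_mkcond/=; apply: eq_bigr => k _.
  by case: ifPn => // /negPn/eqP ->.
rewrite -natr_sum !natr_prod; set N := (\sum_(k < n) a k)%N.
have -> : \prod_(1 <= j < N.+1) (n + 2 * j)%:R =
    \prod_(1 <= j < N.+1) (2 * (n%:R / 2) + 2 * j%:R) :> R.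
  by apply: eq_bigr => j _; rewrite natrD natrM; field.
set D := \prod_(k < n) _.
have := Gamma_natD N n2.
set P := \prod_(1 <= j < N.+1) _ => GD.
have P0 : 0 < P by apply: prodr_gt0 => j _; rewrite ltr_wpDr// ?mulr_ge0// mulr_gt0.
have G1 : 0 < Gamma (n%:R / 2 + 1 : R) by rewrite Gamma_gt0// addr_gt0.
rewrite addrAC.
have -> : Gamma (N%:R + n%:R / 2 + 1) = P * Gamma (n%:R / 2 + 1) / 2 ^+ N.
  by rewrite -GD mulfK// expf_neq0// pnatr_eq0.
by field; rewrite !gt_eqF ?exprn_gt0.
Qed.

End integer_moments.

(** * Asymptotics of the integral over the ball *)

Section asymptotics.
Context {R : realType} {n : nat}.
Implicit Types (b g : 'I_n -> R) (m : nat).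

Definition stirling_quot (a s : R) : R :=
  Gamma (s + a) / (Num.sqrt (2 * pi) * expR (- s) * s `^ (s + a - 1 / 2)).

Lemma cvg_coord_first_to_pinfty m g (k : 'I_n) : (k < m)%N ->
  b k @[b --> first_to_pinfty m g] --> +oo.
Proof.
move=> km; apply/cvgryPgt => A.
by exists A => // b /(_ k)[/(_ km)].
Qed.

Lemma cvg_multi_sum_first_to_pinfty m g : (1 <= m <= n)%N ->
  multi_sum b @[b --> first_to_pinfty m g] --> +oo.
Proof.
move=> /andP[m1 mn]; apply/cvgryPgt => A.
pose c := \sum_(k < n | (m <= k)%N) g k.
(* Here [c] is the sum of the fixed coordinates. Coordinate 0 alone exceeds [A - c], and the bound 0
   keeps the other growing coordinates from lowering the sum. *)
exists (Num.max 0 (A - c)) => // b hb.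
have i0 : (0 < n)%N by exact: leq_trans mn.
rewrite /multi_sum (bigID (fun k : 'I_n => (m <= k)%N))/=.
rewrite (eq_bigr g); last by move=> k /((hb k).2).
rewrite -/c addrC -ltrBlDr (bigD1 (Ordinal i0))/=; last by rewrite -ltnNge.
rewrite ltr_wpDr//.
  apply: sumr_ge0 => k /andP[km _].
  have [/(_ _)] := hb k; rewrite ltnNge => /(_ km) + _.
  by rewrite gt_max => /andP[/ltW].
have [/(_ m1)] := hb (Ordinal i0).
by rewrite gt_max => /andP[].
Qed.

(** An exact identity. The [m] Stirling factors above and the one below leave [sqrt (2 pi)] to the
    power [m - 1]; the exponentials leave that of the sum of the coordinates from [m] on. *)
Lemma asymptotic_quotE m b : (1 <= m <= n)%N ->
  (forall k : 'I_n, (k < m)%N -> 0 < b k) -> (forall k, - (1 / 2) < b k) ->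
  0 < multi_sum b ->
  (\int[lebesgue_tuple R n]_(x in unit_ball) monomial2 b x) /
     ((2 * pi) `^ ((m%:R - 1) / 2) *
         expR (\sum_(k < n | (m <= k)%N) b k) *
         (\prod_(k < n | (m <= k)%N) Gamma (b k + 1 / 2)) *
         ((\prod_(k < n | (k < m)%N) b k `^ b k) /
          multi_sum b `^ (multi_sum b + (n%:R + 1) / 2))) =
  (\prod_(k < n | (k < m)%N) stirling_quot (1 / 2) (b k)) /
  stirling_quot (1 + n%:R / 2) (multi_sum b).
Proof.
move=> /andP[m1 mn] bm hb S0.
rewrite /Rintegral integral_ball//=.
have G0 := Gamma_gt0 (multi_sum_gt hb).
have split1 F : \prod_(k < n) F k =
    \prod_(k < n | (k < m)%N) F k * \prod_(k < n | (m <= k)%N) F k :> R.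
  rewrite (bigID (fun k : 'I_n => (k < m)%N))/=; congr (_ * _).
  by apply: eq_bigl => k; rewrite -leqNgt.
have split2 : multi_sum b = \sum_(k < n | (k < m)%N) b k + \sum_(k < n | (m <= k)%N) b k.
  rewrite /multi_sum (bigID (fun k : 'I_n => (k < m)%N))/=; congr (_ + _).
  by apply: eq_bigl => k; rewrite -leqNgt.
rewrite (split1 (fun k => Gamma (b k + 1 / 2))).
set P1 := \prod_(k < n | (k < m)%N) Gamma _.
set P2 := \prod_(k < n | (m <= k)%N) Gamma _.
set B := \prod_(k < n | (k < m)%N) b k `^ b k.
set E2 := \sum_(k < n | (m <= k)%N) b k in split2 *.
set E1 := \sum_(k < n | (k < m)%N) b k in split2 *.
have w0 : 0 < Num.sqrt (2 * pi : R) by rewrite sqrtr_gt0 mulr_gt0 ?pi_gt0.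
have P20 : 0 < P2 by apply: prodr_gt0 => k _; apply: Gamma_gt0; have := hb k; lra.
have B0 : 0 < B by apply: prodr_gt0 => k km; rewrite powR_gt0// bm.
have -> : \prod_(k < n | (k < m)%N) stirling_quot (1 / 2) (b k) =
    P1 / (Num.sqrt (2 * pi) ^+ m * expR (- E1) * B).
  rewrite /stirling_quot.
  transitivity (\prod_(k < n | (k < m)%N) (Gamma (b k + 1 / 2) *
      (Num.sqrt (2 * pi) * expR (- b k) * b k `^ b k)^-1)).
    by apply: eq_bigr => k _; rewrite addrK.
  rewrite big_split/= prodfV !big_split/= -sumrN expR_sum; congr (_ / (_ * _ * _)).
  rewrite -(big_ord_widen n (fun=> Num.sqrt (2 * pi)) mn).
  by rewrite prodr_const card_ord.
have -> : (2 * pi) `^ ((m%:R - 1) / 2) = Num.sqrt (2 * pi) ^+ m / Num.sqrt (2 * pi) :> R.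
  have p0 : 0 < 2 * pi :> R by rewrite mulr_gt0 ?pi_gt0.
  rewrite -powR_mulrn ?(ltW w0)// -powR12_sqrt ?(ltW p0)// -powRrM.
  rewrite -powRB ?(gt_eqF p0) ?implybT//.
  by congr (_ `^ _); field.
rewrite /stirling_quot.
have -> : multi_sum b + (1 + n%:R / 2) - 1 / 2 = multi_sum b + (n%:R + 1) / 2.
  by field.
rewrite addrA.
have V0 : 0 < multi_sum b `^ (multi_sum b + (n%:R + 1) / 2) by rewrite powR_gt0.
move: (multi_sum b `^ _) (Gamma (multi_sum b + _ + _)) V0 G0 => V GS V0 G0.
rewrite split2 opprD expRD !expRN.
by field; rewrite !gt_eqF ?expR_gt0 ?exprn_gt0.
Qed.

Lemma cvg_stirling_quot T (F : set_system T) {FF : Filter F} (a : R) (f : T -> R) :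
  0 <= a -> f @ F --> +oo -> stirling_quot a (f x) @[x --> F] --> (1 : R).
Proof. by move=> a0 hf; apply: (cvg_comp _ _ hf); exact: cvg_Gamma_stirling. Qed.

Lemma asymptotics_first m g : (1 <= m <= n)%N ->
  (forall k : 'I_n, (m <= k)%N -> - (1 / 2) < g k) ->
  (\int[lebesgue_tuple R n]_(x in unit_ball) monomial2 b x) /
     ((2 * pi) `^ ((m%:R - 1) / 2) *
         expR (\sum_(k < n | (m <= k)%N) b k) *
         (\prod_(k < n | (m <= k)%N) Gamma (b k + 1 / 2)) *
         ((\prod_(k < n | (k < m)%N) b k `^ b k) /
          multi_sum b `^ (multi_sum b + (n%:R + 1) / 2)))
    @[b --> first_to_pinfty m g] --> (1 : R).
Proof.
move=> mn hg.
have h : (\prod_(k < n | (k < m)%N) stirling_quot (1 / 2) (b k)) *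
    (stirling_quot (1 + n%:R / 2) (multi_sum b))^-1
    @[b --> first_to_pinfty m g] --> (1 : R).
  rewrite [X in _ --> X](_ : 1 = (\prod_(k < n | (k < m)%N) (1 : R)) * 1^-1); last first.
    by rewrite big1// invr1 mulr1.
  apply: cvgM; last first.
    apply: cvgV; first exact: oner_neq0.
    apply: cvg_stirling_quot; first by rewrite addr_ge0.
    exact: cvg_multi_sum_first_to_pinfty.
  apply: (cvg_big (@mul_continuous R)) => k km.
  by apply: cvg_stirling_quot => //; exact: cvg_coord_first_to_pinfty.
apply: cvg_trans h; apply: near_eq_cvg.
(* The sign conditions of the identity hold eventually along the filter. *)
near=> b; rewrite asymptotic_quotE//.
- near: b; exists 0 => // b hb k km; have [h _] := hb k.
  exact: h.
- near: b; exists 0 => // b hb k; have [h1 h2] := hb k.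
  by case: (ltnP k m) => [/h1|km]; [lra|rewrite h2// hg].
- near: b.
  by move/cvgryPgt : (cvg_multi_sum_first_to_pinfty g mn) => /(_ 0).
Unshelve. all: end_near. Qed.

End asymptotics.

Unset Implicit Arguments.

Theorem proposition2p2 (R : realType) (n : nat) (hn : (3 <= n)%N) :
  (forall b : 'I_n -> R, (forall k, - (1 / 2) < b k) ->
     (\int[lebesgue_tuple R n]_(x in unit_ball) (monomial2 b x)%:E)%E =
     (1 / Gamma ((multi_sum b + 1) + n%:R / 2) *
        \prod_(k < n) Gamma (b k + 1 / 2))%:E) /\
  (forall a : 'I_n -> nat,
     ((1 / ball_volume n)%:E * \int[lebesgue_tuple R n]_(x in unit_ball)
        (monomial2 (fun k => (a k)%:R) x)%:E)%E =
     ((\prod_(k < n | a k != 0%N) double_fact (2 * a k - 1))%N%:R /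
      (\prod_(1 <= j < (\sum_(k < n) a k).+1) (n + 2 * j))%N%:R)%:E) /\
  (forall (m : nat) (g : 'I_n -> R), (1 <= m)%N -> (m <= n)%N ->
     (forall k : 'I_n, (m <= k)%N -> - (1 / 2) < g k) ->
     (fun b : 'I_n -> R =>
        (\int[lebesgue_tuple R n]_(x in unit_ball) monomial2 b x) /
        ((2 * pi) `^ ((m%:R - 1) / 2) *
         expR (\sum_(k < n | (m <= k)%N) b k) *
         (\prod_(k < n | (m <= k)%N) Gamma (b k + 1 / 2)) *
         ((\prod_(k < n | (k < m)%N) b k `^ b k) /
          multi_sum b `^ (multi_sum b + (n%:R + 1) / 2))))
       @ first_to_pinfty m g --> (1 : R)) /\
  (fun b : 'I_n -> R =>
     (\int[lebesgue_tuple R n]_(x in unit_ball) monomial2 b x) /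
     ((2 * pi) `^ ((n%:R - 1) / 2) *
      ((\prod_(k < n) b k `^ b k) /
       multi_sum b `^ (multi_sum b + (n%:R + 1) / 2))))
    @ all_to_pinfty --> (1 : R).
Proof.
have n0 : (0 < n)%N by exact: leq_trans hn.
split; first by move=> b hb; exact: integral_ball.
split.
  move=> a; rewrite integral_ball; last first.
    by move=> k; apply: (@lt_le_trans _ _ 0); [lra|rewrite ler0n].
  by rewrite -EFinM; congr (_%:E); exact: mean_monomial2_nat.
split; first by move=> m g m1 mn; apply: asymptotics_first; rewrite m1.
have n1 : (1 <= n <= n)%N by rewrite n0 leqnn.
(* The last claim is the case [m = n]: no index satisfies [n <= k], so the two filters coincide and
   the sum and product over such indices are empty. *)
have := @asymptotics_first R n n (fun=> 0) n1.
have geF (k : 'I_n) : (n <= k)%N = false by apply/negbTE; rewrite -ltnNge.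
have -> : @first_to_pinfty R n n (fun=> 0) = all_to_pinfty.
  congr filter_from; apply/funext => M; apply/seteqP; split => b /= hb k.
    by have [h _] := hb k; exact: h.
  by split => //; rewrite geF.
move=> /(_ _) h; apply: cvg_trans (h _); last by move=> k; rewrite geF.
apply: near_eq_cvg; apply: nearW => b.
have -> : \prod_(k < n | (k < n)%N) b k `^ b k = \prod_(k < n) b k `^ b k.
  by apply: eq_bigl => k; rewrite ltn_ord.
under eq_bigl do rewrite geF.
under [X in _ * X * _]eq_bigl do rewrite geF.
by rewrite !big_pred0_eq expR0 !mulr1.
Qed.
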